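(* As a cluster algebra, $\mathbb{C}[\mathbb{G}(3,6)]$ possesses exactly sixteen cluster variables. Fourteen of these are the Plücker coordinates $\Delta^{ijk}$ with $\{i,j,k\}\subset[1\dots6]$ an internal $3$-subset, and the remaining two are the quadratic regular functions $X^{123456}$ and $Y^{123456}$. The zero locus of $X^{123456}$ consists of those configurations of six points $[v_1],\dots,[v_6]$ in $\mathbb{RP}^2$ for which the three lines - joining $[v_1]$ with $[v_2]$, $[v_3]$ with $[v_4]$, and $[v_5]$ with $[v_6]$ - have a common intersection point. The cluster variable $Y^{123456}$ satisfies $$Y^{123456}(v_1,v_2,v_3,v_4,v_5,v_6)=X^{123456}(v_6,v_1,v_2,v_3,v_4,v_5),$$ and consequently its vanishing locus is that of $X^{123456}$ with the indices cyclically shifted.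
   Context: Grassmannian. $X(k,n)\subset\bigwedge^k\mathbb{C}^n$ is the affine cone of decomposable $k$-forms, with Plücker coordinates $\Delta^K$ indexed by $k$-subsets $K\subset\{1,\dots,n\}$. $\mathbb{C}[\mathbb{G}(k,n)]$ denotes the coordinate ring of $X(k,n)$. A $k$-subset is internal if it is not a cyclic interval modulo $n$. A point of $\mathbb{G}(3,n)$ is represented by a real $3\times n$ matrix $(v_1\ \dots\ v_n)$ with nonzero columns $v_i\in\mathbb{R}^3$; to it is associated the ordered configuration $[v_1],\dots,[v_n]$ in the real projective plane $\mathbb{RP}^2$; $\Delta^{abc}=\det(v_a\ v_b\ v_c)$ for $a<b<c$. The description of zero loci refers to configurations for which the lines mentioned are defined (the two points being joined are distinct). The functions $X^{123456},Y^{123456}$ are $X^{123456}=\Delta^{134}\Delta^{256}-\Delta^{156}\Delta^{234}$ and $Y^{123456}=\Delta^{145}\Delta^{236}-\Delta^{123}\Delta^{456}$. Seeds and mutation. A seed in a field $\mathcal{F}$ of rational functions over $\mathbb{C}$ in $M$ variables is a triple $(\mathbf{x},\mathbf{c},\tilde B)$ where $\tilde{\mathbf{x}}=\mathbf{x}\sqcup\mathbf{c}$ is a transcendence basis of $\mathcal{F}$ ($M$ algebraically independent elements) and $\tilde B=(b_{x,y})$ is an integer matrix with rows indexed by $\tilde{\mathbf x}$ and columns by $\mathbf{x}$ whose square submatrix with rows in $\mathbf{x}$ is skew-symmetrizable. For $z\in\mathbf{x}$, $\mu_z(\mathbf{x},\mathbf{c},\tilde B)=(\mathbf{x}-\{z\}\cup\{z'\},\mathbf{c},\tilde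 B')$, where $zz'=\prod_{b_{x,z}>0}x^{b_{x,z}}+\prod_{b_{x,z}<0}x^{-b_{x,z}}$ and $b'_{x,y}=-b_{x,y}$ if $x=z$ or $y=z$, $b'_{x,y}=b_{x,y}+\frac{|b_{x,z}|b_{z,y}+b_{x,z}|b_{z,y}|}{2}$ otherwise (index $z$ renamed $z'$). Clusters are the sets $\mathbf{x}$ in seeds obtained from an initial seed by iterated mutation; their elements are the cluster variables. Cluster structure on $\mathbb{C}[\mathbb{G}(k,n)]$ (here $k=3$, $n=6$). $\mathcal{F}$ is the fraction field of $\mathbb{C}[\mathbb{G}(k,n)]$. For $0\le i\le k$, $0\le j\le n-k$ put $p_{ij}=n-k-\lfloor\frac{i+j-2}{2}\rfloor$, $p'_{ij}=n-k+2+\lfloor\frac{i+j-1}{2}\rfloor$ and $I_{ij}=\{p_{ij},\dots,p_{ij}+i-1\}\sqcup\{p'_{ij},\dots,p'_{ij}+k-i-1\}$ (mod $n$; only non-corner pairs $(i,j)$ are used). The initial cluster is $\{\Delta^{I_{ij}}: 1\le i\le k-1,\ 1\le j\le n-k-1\}$; the coefficients $\mathbf{c}$ are the $\Delta^{K}$ for the $n$ cyclic intervals $K$ of length $k$ (these are the $I_{ij}$ with $i\in\{0,k\}$ or $j\in\{0,n-k\}$). In the column of $\tilde B$ indexed by $I_{ij}$ the entries in rows $I_{i\pm1,j}$ equal $(-1)^{i+j}$, the entries in rows $I_{i,j\pm1}$ equal $-(-1)^{i+j}$, and all other entries are $0$. *)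

(* Defs.v *)
(* The field of complex numbers is R[i] for R : realType. *)
From HB Require Import structures.
From mathcomp Require Import all_boot all_order all_algebra.
From mathcomp Require Import boolp reals.
From mathcomp Require Import ring_quotient fraction generic_quotient.
From mathcomp.real_closed Require Import complex.
From mathcomp Require Import mpoly.

Set Implicit Arguments.
Unset Strict Implicit.
Unset Printing Implicit Defensive.

Import Order.TTheory GRing.Theory Num.Theory.
Local Open Scope ring_scope.
Local Open Scope quotient_scope.

Notation ksubset k n := {A : {set 'I_n} | #|A| == k}.

Section Pluecker.
Variables (R : comNzRingType) (k n : nat).

(* The t-th element of A in increasing order. *)
Definition ksubset_nth (A : ksubset k n) (t : 'I_k) : 'I_n :=
  enum_val (cast_ord (esym (eqP (valP A))) t).

(* For w_1, ..., w_k the rows of M, this is the coefficient of                *)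
(* e_{a_1} /\ ... /\ e_{a_k} (a_1 < ... < a_k the elements of A) in           *)
(* w_1 /\ ... /\ w_k.                                                         *)
Definition minor (M : 'M[R]_(k, n)) (A : ksubset k n) : R :=
  \det (colsub (ksubset_nth A) M).

(* A point of the k-th exterior power of R^n is given by its coordinates in   *)
(* the basis of the e_A, enumerated by 'I_#|ksubset k n|.                     *)
Definition pluecker (M : 'M[R]_(k, n)) : 'I_#|{: ksubset k n}| -> R :=
  fun m => minor M (enum_val m).

Definition decomposable (v : 'I_#|{: ksubset k n}| -> R) : Prop :=
  exists M : 'M[R]_(k, n), v =1 pluecker M.

End Pluecker.

Section CoordinateRing.
Variables (K : numFieldType) (k n : nat).
Local Notation N := #|{: ksubset k n}|.

Definition vanishing_ideal : {pred {mpoly K[N]}} :=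
  fun f => `[< forall v : 'I_N -> K, decomposable v -> f.@[v] = 0 >].

Lemma vanishing_idealP (f : {mpoly K[N]}) :
  reflect (forall M : 'M[K]_(k, n), f.@[pluecker M] = 0)
          (f \in vanishing_ideal).
Proof.
apply: (iffP idP) => [/asboolP f0 M|f0]; first by apply: f0; exists M.
by apply/asboolP => v [M vM]; rewrite (meval_eq _ vM).
Qed.

Lemma vanishing_ideal_closed : idealr_closed vanishing_ideal.
Proof.
split.
- by apply/vanishing_idealP => M; rewrite meval0.
- by apply/vanishing_idealP => /(_ 0)/eqP; rewrite meval1 oner_eq0.
- move=> f u v /vanishing_idealP u0 /vanishing_idealP v0.
  by apply/vanishing_idealP => M; rewrite mevalD mevalM u0 v0 mulr0 addr0.
Qed.

HB.instance Definition _ :=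
  isIdealr.Build {mpoly K[N]} vanishing_ideal vanishing_ideal_closed.

Lemma horner_line (A B : 'M[K]_(k, n)) (f : {mpoly K[N]}) (t : K) :
  (mmap polyC (pluecker (map_mx polyC A + 'X *: map_mx polyC (B - A))) f).[t]
    = f.@[pluecker (A + t *: (B - A))].
Proof.
rewrite [in RHS]mevalE /mmap horner_sum; apply: eq_bigr => m _.
rewrite hornerM hornerC; congr (_ * _).
rewrite /mmap1 horner_prod; apply: eq_bigr => i _; rewrite horner_exp.
congr (_ ^+ _); rewrite /pluecker /minor.
rewrite -[LHS]/(horner_eval t _) -det_map_mx; congr (\det _).
apply/matrixP => a b; rewrite !mxE /= /horner_eval.
by rewrite hornerD hornerM hornerX !hornerC.
Qed.

Lemma vanishing_ideal_prime : prime_idealr_closed vanishing_ideal.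
Proof.
move=> f g /vanishing_idealP fg0.
case: (boolP (f \in vanishing_ideal)) => //= /vanishing_idealP/existsNP[A fA].
apply/vanishing_idealP => B; apply: contrapT => gB.
set P := pluecker (map_mx polyC A + 'X *: map_mx polyC (B - A)).
have FG0 : mmap polyC P f * mmap polyC P g = 0.
  apply/eqP; apply: contrapT => /negP H.
  pose s : seq K := [seq i%:R | i <- iota 0 (size (mmap polyC P f * mmap polyC P g))].
  have /(_ s) := max_poly_roots H.
  rewrite size_map size_iota ltnn => /(_ _ _)/negP; apply => //.
    by apply/allP => x _; apply/rootP; rewrite hornerM !horner_line -mevalM fg0.
  by rewrite map_inj_uniq ?iota_uniq // => i j /eqP; rewrite eqr_nat => /eqP.
move/eqP: FG0; rewrite mulf_eq0 => /orP[]/eqP.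
- move/(congr1 (horner^~ 0)); rewrite /= horner0 horner_line scale0r addr0.
  exact: fA.
- move/(congr1 (horner^~ 1)); rewrite /= horner0 horner_line scale1r addrC subrK.
  exact: gB.
Qed.

HB.instance Definition _ :=
  isPrimeIdealrClosed.Build {mpoly K[N]} vanishing_ideal vanishing_ideal_prime.

(* The coordinate ring of the cone of decomposable k-forms. *)
Definition grass_ring : Type := {ideal_quot vanishing_ideal}.

HB.instance Definition _ := GRing.ComNzRing.on grass_ring.
HB.instance Definition _ := EqQuotient.on grass_ring.
HB.instance Definition _ :=
  NzRingQuotient.on grass_ring.

(* mathcomp fraction fields are built over integral domains equipped with an  *)
(* inverse operation on units, here supplied classically.                     *)
Definition grass_unit : {pred grass_ring} := fun x => `[< exists y, y * x == 1 >].

Definition grass_inv (x : grass_ring) : grass_ring :=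
  if pselect (exists y, y * x == 1) is left e then xchoose e else x.

Lemma grass_mulVr : {in grass_unit, left_inverse 1 grass_inv *%R}.
Proof.
move=> x /asboolP xu; rewrite /grass_inv; case: pselect => // e.
exact/eqP/(xchooseP e).
Qed.

Lemma grass_unitP (x y : grass_ring) : y * x = 1 -> grass_unit x.
Proof. by move=> yx; apply/asboolP; exists y; apply/eqP. Qed.

Lemma grass_inv_out : {in [predC grass_unit], grass_inv =1 id}.
Proof.
move=> x /negP xu; rewrite /grass_inv; case: pselect => // e.
by case: xu; apply/asboolP.
Qed.

HB.instance Definition _ := GRing.ComNzRing_hasMulInverse.Build grass_ring
  grass_mulVr grass_unitP grass_inv_out.

Lemma grass_idomain : GRing.integral_domain_axiom grass_ring.
Proof. exact: Quotient.rquot_IdomainAxiom. Qed.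

HB.instance Definition _ :=
  GRing.ComUnitRing_isIntegral.Build grass_ring grass_idomain.

Definition grass_field : fieldType := {fraction grass_ring}.

Definition regular_frac (f : grass_ring) : grass_field := tofrac f.

Definition scalar_frac (c : K) : grass_field :=
  regular_frac (\pi_grass_ring c%:MP).

Lemma scalar_frac_is_zmod : zmod_morphism scalar_frac.
Proof.
by move=> a b; rewrite /scalar_frac /regular_frac mpolyCB !rmorphB.
Qed.

Lemma scalar_frac_is_monoid : monoid_morphism scalar_frac.
Proof.
split=> [|a b]; rewrite /scalar_frac /regular_frac; first by rewrite !rmorph1.
by rewrite mpolyCM !rmorphM.
Qed.

HB.instance Definition _ :=
  GRing.isZmodMorphism.Build K grass_field scalar_frac scalar_frac_is_zmod.
HB.instance Definition _ :=
  GRing.isMonoidMorphism.Build K grass_field scalar_frac scalar_frac_is_monoid.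

(* The coordinate function of e_A; 0 (never used) when A is not a k-subset. *)
Definition Delta (A : {set 'I_n}) : grass_ring :=
  if insub A is Some B then \pi_grass_ring 'X_(enum_rank (B : ksubset k n))
  else 0.

(* The value of f at the decomposable form represented by M; independent of   *)
(* the chosen representative of f by regular_at_pi.                           *)
Definition regular_at (f : grass_ring) (M : 'M[K]_(k, n)) : K :=
  (repr f).@[pluecker M].

Lemma regular_at_pi (p : {mpoly K[N]}) (M : 'M[K]_(k, n)) :
  regular_at (\pi_grass_ring p) M = p.@[pluecker M].
Proof.
have /vanishing_idealP/(_ M)/eqP : repr (\pi_grass_ring p) - p \in vanishing_ideal.
  by rewrite Quotient.idealrBE reprK.
by rewrite mevalB subr_eq0 => /eqP.
Qed.

End CoordinateRing.

Section Seeds.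
Variables (F : fieldType) (I J : finType).

(* Seeds are labelled: I indexes the cluster and J the coefficients, so that  *)
(* renaming z into z' is implicit in a mutation.                              *)
Record seed := Seed { seed_var : I + J -> F; seed_mx : I + J -> I -> int }.

Definition mutate_var (s : seed) (z : I) : F :=
  (\prod_(r | 0 < seed_mx s r z) seed_var s r ^+ `|seed_mx s r z|%N
   + \prod_(r | seed_mx s r z < 0) seed_var s r ^+ `|seed_mx s r z|%N)
  / seed_var s (inl z).

Definition mutate_mx (s : seed) (z : I) (r : I + J) (y : I) : int :=
  let b := seed_mx s in
  if (r == inl z) || (y == z) then - b r y
  else b r y
       + ((`|b r z| * b (inl z) y + b r z * `|b (inl z) y|) %/ 2)%Z.

Definition mutate (s : seed) (z : I) : seed :=
  Seed (fun r => if r == inl z then mutate_var s z else seed_var s r)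
       (mutate_mx s z).

Inductive mutation_equiv (s0 : seed) : seed -> Prop :=
| mutation_refl : mutation_equiv s0 s0
| mutation_step s z :
    mutation_equiv s0 s -> mutation_equiv s0 (mutate s z).

Definition cluster (s : seed) (x : F) : Prop :=
  exists i : I, x = seed_var s (inl i).

Definition cluster_variable (s0 : seed) (x : F) : Prop :=
  exists2 s, mutation_equiv s0 s & cluster s x.

Definition coefficient (s0 : seed) (x : F) : Prop :=
  exists j : J, x = seed_var s0 (inr j).

Variables (K : fieldType) (iota : {rmorphism K -> F}).

Definition algebraically_independent (L : finType) (x : L -> F) : Prop :=
  forall P : {mpoly K[#|L|]}, mmap iota (x \o enum_val) P = 0 -> P = 0.

(* z is algebraic over K(x) when it is a root of a nonzero polynomial with    *)
(* coefficients in K[x].                                                      *)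
Definition algebraic_over (L : finType) (x : L -> F) (z : F) : Prop :=
  exists Q : {poly {mpoly K[#|L|]}},
    let q := \poly_(d < size Q) mmap iota (x \o enum_val) Q`_d in
    q != 0 /\ root q z.

Definition transcendence_basis (L : finType) (x : L -> F) : Prop :=
  algebraically_independent x /\ forall z : F, algebraic_over x z.

Definition skew_symmetrizable (B : I -> I -> int) : Prop :=
  exists2 d : I -> int, (forall i, 0 < d i)
    & forall i j, d i * B i j = - (d j * B j i).

Definition is_seed (s : seed) : Prop :=
  transcendence_basis (seed_var s)
  /\ skew_symmetrizable (fun i j => seed_mx s (inl i) j).

(* The K-subalgebra of F generated by cluster variables and coefficients. *)
Definition cluster_algebra (s0 : seed) (z : F) : Prop :=
  exists (m : nat) (g : 'I_m -> F) (P : {mpoly K[m]}),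
    (forall a, cluster_variable s0 (g a) \/ coefficient s0 (g a))
    /\ z = mmap iota g P.

End Seeds.

(* The ordinal a : 'I_n carries the label a + 1 in {1, ..., n}. *)
Definition labelled (n : nat) (s : seq nat) : {set 'I_n} :=
  [set a : 'I_n | a.+1 \in s].

(* {p, p + 1, ..., p + l - 1} mod n *)
Definition cyclic_arc (n : nat) (p : int) (l : nat) : {set 'I_n} :=
  [set a : 'I_n |
     [exists t : 'I_l, (a.+1%:Z == p + (t : nat)%:Z %[mod n%:Z])%Z]].

Definition cyclic_interval (k n : nat) (A : {set 'I_n}) : bool :=
  [exists s : 'I_n, A == cyclic_arc n s.+1%:Z k].

Definition internal (k n : nat) : {set {set 'I_n}} :=
  [set A : {set 'I_n} | (#|A| == k) && ~~ cyclic_interval k A].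

Section InitialSeed.
Variables (K : numFieldType) (k n : nat).

Definition p_start (i j : nat) : int :=
  n%:Z - k%:Z - ((i%:Z + j%:Z - 2) %/ 2)%Z.

Definition p'_start (i j : nat) : int :=
  n%:Z - k%:Z + 2 + ((i%:Z + j%:Z - 1) %/ 2)%Z.

Definition Iset (i j : nat) : {set 'I_n} :=
  cyclic_arc n (p_start i j) i :|: cyclic_arc n (p'_start i j) (k - i).

(* (i, j) stands for the pair (i + 1, j + 1), which ranges over               *)
(* 1 <= i + 1 <= k - 1 and 1 <= j + 1 <= n - k - 1.                           *)
Definition mutable_index := ('I_k.-1 * 'I_(n - k).-1)%type.
Definition frozen_index := {A : {set 'I_n} | cyclic_interval k A}.

Definition row_set (r : mutable_index + frozen_index) : {set 'I_n} :=
  match r with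
  | inl u => Iset u.1.+1 u.2.+1
  | inr A => val A
  end.

Definition initial_mx (r : mutable_index + frozen_index)
    (u : mutable_index) : int :=
  let i := u.1.+1 in let j := u.2.+1 in
  if row_set r \in [:: Iset i.-1 j; Iset i.+1 j] then (-1) ^+ (i + j)
  else if row_set r \in [:: Iset i j.-1; Iset i j.+1] then - (-1) ^+ (i + j)
  else 0.

Definition initial_seed :
    seed (grass_field K k n) mutable_index frozen_index :=
  Seed (fun r => regular_frac (Delta K k (row_set r))) initial_mx.

End InitialSeed.

Section SixPoints.
Variable K : numFieldType.

Local Notation D s := (Delta K 3 (labelled 6 s)).

Definition X123456 : grass_ring K 3 6 :=
  D [:: 1; 3; 4]%N * D [:: 2; 5; 6]%N - D [:: 1; 5; 6]%N * D [:: 2; 3; 4]%N.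

Definition Y123456 : grass_ring K 3 6 :=
  D [:: 1; 4; 5]%N * D [:: 2; 3; 6]%N - D [:: 1; 2; 3]%N * D [:: 4; 5; 6]%N.

Definition six_columns (v1 v2 v3 v4 v5 v6 : 'cV[K]_3) : 'M[K]_(3, 6) :=
  \matrix_(i, j) (nth 0 [:: v1; v2; v3; v4; v5; v6] j) i 0.

(* The points of the projective plane are the lines <[v]> of K^3, v != 0, and *)
(* the projective line joining <[v]> and <[w]> is the plane <[v]> + <[w]>.    *)
Definition concurrent (L1 L2 L3 : {vspace 'cV[K]_3}) : Prop :=
  exists P : {vspace 'cV[K]_3},
    [/\ \dim P = 1, (P <= L1)%VS, (P <= L2)%VS & (P <= L3)%VS].

End SixPoints.

Definition complexify (R : realType) (m n : nat) (M : 'M[R]_(m, n)) :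
  'M[R[i]]_(m, n) := map_mx (real_complex R) M.

(* Main.v *)
Require Import Defs.
From HB Require Import structures.
From mathcomp Require Import all_boot all_order all_algebra.
From mathcomp Require Import boolp reals.
From mathcomp Require Import ring_quotient fraction generic_quotient.
From mathcomp.real_closed Require Import complex.
From mathcomp Require Import mpoly.
From mathcomp Require Import ring.

Set Implicit Arguments.
Unset Strict Implicit.
Unset Printing Implicit Defensive.

Import Order.TTheory GRing.Theory Num.Theory.
Local Open Scope ring_scope.

(** The cluster structure on C[G(3,6)] is of Dynkin type D4, hence finite: its
    seeds can be listed and a finite verification shows that the list is closed
    under mutation.  What makes the list short is that an exchange relation
    z z' = P + N depends only on the pair (z, z') and not on the seed in which
    z is exchanged for z', and that even the sign of the exponents is the same
    in all these seeds.  So a seed is determined by its cluster: the column of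
    its matrix at z is read off from the relation that removes z.  The data are
    therefore sixteen labels, the 52 three-term relations between them, and the
    50 clusters, which are the sets of four pairwise compatible labels.
    [models_closed] mutates each of the 50 seeds in each of its four directions,
    at the level of labels and integer matrices, and checks that the result is
    again one of them; [represents_mutate] transports this to the field of
    rational functions, and [walk_covers] follows a path of twelve mutations
    that meets all sixteen labels.  This is [cluster_variableP].

    The relations themselves hold because a regular function is determined by
    its values on 3 x 6 matrices ([evaluation_inj]), where each of them becomes
    a polynomial identity in 18 entries ([exchange_relations_value]).  The
    sixteen functions are distinct because one integer matrix separates them.

    The ten initial functions are algebraically independent: sending v_3 and
    v_6 to two basis vectors, one solves for the other entries of the matrix so
    that the ten minors take prescribed values, dividing only by the four
    initial cluster variables ([initial_minors_onto]); a polynomial relation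
    would then vanish on a dense set of points.  They generate the field of
    rational functions, since every Pluecker coordinate is a coefficient or is
    obtained from the initial seed by mutations, which are rational operations.
    That each Pluecker coordinate is a cluster variable or a coefficient also
    shows that the cluster algebra contains every regular function; it contains
    nothing else because cluster variables and coefficients are regular.

    Finally, the bracket of the three normal covectors of the planes spanned by
    (v_1, v_2), (v_3, v_4), (v_5, v_6) is X(v_1, ..., v_6) ([bracket_normals]),
    so X vanishes if and only if the three planes share a nonzero vector, and
    Y(v_1, ..., v_6) is X(v_6, v_1, ..., v_5) by inspection of the brackets. *)

(** * Labels, exchange relations and model seeds *)

(** A label abc stands for the Pluecker coordinate of {a, b, c}; a label of six
    digits abcdef stands for X^{abcdef}, so that Y^{123456} = X^{612345} is also
    named by its digits. *)
Definition label := seq nat.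
Definition tri (a b c : nat) : label := [:: a; b; c].
Definition X_label : label := [:: 1; 2; 3; 4; 5; 6]%N.
Definition Y_label : label := [:: 6; 1; 2; 3; 4; 5]%N.

Definition internal_labels : seq label :=
  [:: tri 1 2 4; tri 1 2 5; tri 1 3 4; tri 1 3 5; tri 1 3 6; tri 1 4 5;
      tri 1 4 6; tri 2 3 5; tri 2 3 6; tri 2 4 5; tri 2 4 6; tri 2 5 6;
      tri 3 4 6; tri 3 5 6].
Definition mutable_labels : seq label := internal_labels ++ [:: X_label; Y_label].
Definition frozen_labels : seq label :=
  [:: tri 1 2 3; tri 2 3 4; tri 3 4 5; tri 4 5 6; tri 1 5 6; tri 1 2 6].

(** (z, z', P, N) encodes z z' = P + N, where P collects the rows with a positive
    entry in the column of z, for every seed in which z is exchanged for z'. *)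
Definition exchange : Type := (label * label) * (seq label * seq label).
Definition ex_old (e : exchange) : label := e.1.1.
Definition ex_new (e : exchange) : label := e.1.2.
Definition ex_pos (e : exchange) : seq label := e.2.1.
Definition ex_neg (e : exchange) : seq label := e.2.2.

(** Each unordered exchangeable pair occurs once.  A relation with a monomial of
    one factor X or Y is one of the ways to write that function; those of degree
    three arise when X or Y itself is exchanged. *)
Definition exchange_relations : seq exchange :=
  let rel x x' P N : exchange := ((x, x'), (P, N)) in
  [::
   rel (tri 1 2 4) (tri 1 3 5) [:: tri 1 2 3; tri 1 4 5] [:: tri 1 2 5; tri 1 3 4];
   rel (tri 1 2 4) (tri 1 3 6) [:: tri 1 2 3; tri 1 4 6] [:: tri 1 2 6; tri 1 3 4];
   rel (tri 1 2 4) (tri 2 3 5) [:: tri 1 2 3; tri 2 4 5] [:: tri 1 2 5; tri 2 3 4];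
   rel (tri 1 2 4) (tri 2 3 6) [:: tri 1 2 3; tri 2 4 6] [:: tri 1 2 6; tri 2 3 4];
   rel (tri 1 2 4) (tri 3 5 6) [:: tri 1 2 3; tri 4 5 6] [:: X_label];
   rel (tri 1 2 4) Y_label [:: tri 1 2 3; tri 1 4 6; tri 2 4 5]
      [:: tri 1 2 6; tri 1 4 5; tri 2 3 4];
   rel (tri 1 2 5) (tri 1 3 6) [:: tri 1 2 3; tri 1 5 6] [:: tri 1 2 6; tri 1 3 5];
   rel (tri 1 2 5) (tri 1 4 6) [:: tri 1 2 4; tri 1 5 6] [:: tri 1 2 6; tri 1 4 5];
   rel (tri 1 2 5) (tri 2 3 6) [:: tri 1 2 3; tri 2 5 6] [:: tri 1 2 6; tri 2 3 5];
   rel (tri 1 2 5) (tri 2 4 6) [:: tri 1 2 4; tri 2 5 6] [:: tri 1 2 6; tri 2 4 5];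
   rel (tri 1 2 5) (tri 3 4 6) [:: X_label] [:: tri 1 2 6; tri 3 4 5];
   rel (tri 1 2 5) Y_label [:: tri 1 2 3; tri 1 5 6; tri 2 4 5]
      [:: tri 1 2 6; tri 1 4 5; tri 2 3 5];
   rel (tri 1 3 4) (tri 2 3 5) [:: tri 1 2 3; tri 3 4 5] [:: tri 1 3 5; tri 2 3 4];
   rel (tri 1 3 4) (tri 2 3 6) [:: tri 1 2 3; tri 3 4 6] [:: tri 1 3 6; tri 2 3 4];
   rel (tri 1 3 4) (tri 2 4 5) [:: tri 1 2 4; tri 3 4 5] [:: tri 1 4 5; tri 2 3 4];
   rel (tri 1 3 4) (tri 2 4 6) [:: tri 1 2 4; tri 3 4 6] [:: tri 1 4 6; tri 2 3 4];
   rel (tri 1 3 4) (tri 2 5 6) [:: X_label] [:: tri 1 5 6; tri 2 3 4];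
   rel (tri 1 3 4) Y_label [:: tri 1 2 3; tri 1 4 6; tri 3 4 5]
      [:: tri 1 3 6; tri 1 4 5; tri 2 3 4];
   rel (tri 1 3 5) (tri 1 4 6) [:: tri 1 3 4; tri 1 5 6] [:: tri 1 3 6; tri 1 4 5];
   rel (tri 1 3 5) (tri 2 3 6) [:: tri 1 2 3; tri 3 5 6] [:: tri 1 3 6; tri 2 3 5];
   rel (tri 1 3 5) (tri 2 4 5) [:: tri 1 2 5; tri 3 4 5] [:: tri 1 4 5; tri 2 3 5];
   rel (tri 1 3 5) (tri 2 5 6) [:: tri 1 2 5; tri 3 5 6] [:: tri 1 5 6; tri 2 3 5];
   rel (tri 1 3 5) (tri 3 4 6) [:: tri 1 3 4; tri 3 5 6] [:: tri 1 3 6; tri 3 4 5];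
   rel (tri 1 3 5) X_label [:: tri 1 2 5; tri 1 3 4; tri 3 5 6]
      [:: tri 1 2 3; tri 1 5 6; tri 3 4 5];
   rel (tri 1 3 5) Y_label [:: tri 1 2 3; tri 1 5 6; tri 3 4 5]
      [:: tri 1 3 6; tri 1 4 5; tri 2 3 5];
   rel (tri 1 3 6) (tri 2 4 5) [:: tri 1 2 6; tri 3 4 5] [:: Y_label];
   rel (tri 1 3 6) (tri 2 4 6) [:: tri 1 2 6; tri 3 4 6] [:: tri 1 4 6; tri 2 3 6];
   rel (tri 1 3 6) (tri 2 5 6) [:: tri 1 2 6; tri 3 5 6] [:: tri 1 5 6; tri 2 3 6];
   rel (tri 1 3 6) X_label [:: tri 1 2 6; tri 1 3 4; tri 3 5 6]
      [:: tri 1 2 3; tri 1 5 6; tri 3 4 6];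
   rel (tri 1 4 5) (tri 2 3 6) [:: tri 1 2 3; tri 4 5 6] [:: Y_label];
   rel (tri 1 4 5) (tri 2 4 6) [:: tri 1 2 4; tri 4 5 6] [:: tri 1 4 6; tri 2 4 5];
   rel (tri 1 4 5) (tri 2 5 6) [:: tri 1 2 5; tri 4 5 6] [:: tri 1 5 6; tri 2 4 5];
   rel (tri 1 4 5) (tri 3 4 6) [:: tri 1 3 4; tri 4 5 6] [:: tri 1 4 6; tri 3 4 5];
   rel (tri 1 4 5) (tri 3 5 6) [:: tri 1 3 5; tri 4 5 6] [:: tri 1 5 6; tri 3 4 5];
   rel (tri 1 4 5) X_label [:: tri 1 2 5; tri 1 3 4; tri 4 5 6]
      [:: tri 1 2 4; tri 1 5 6; tri 3 4 5];
   rel (tri 1 4 6) (tri 2 3 5) [:: Y_label] [:: tri 1 5 6; tri 2 3 4];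
   rel (tri 1 4 6) (tri 2 5 6) [:: tri 1 2 6; tri 4 5 6] [:: tri 1 5 6; tri 2 4 6];
   rel (tri 1 4 6) (tri 3 5 6) [:: tri 1 3 6; tri 4 5 6] [:: tri 1 5 6; tri 3 4 6];
   rel (tri 1 4 6) X_label [:: tri 1 2 6; tri 1 3 4; tri 4 5 6]
      [:: tri 1 2 4; tri 1 5 6; tri 3 4 6];
   rel (tri 2 3 5) (tri 2 4 6) [:: tri 2 3 4; tri 2 5 6] [:: tri 2 3 6; tri 2 4 5];
   rel (tri 2 3 5) (tri 3 4 6) [:: tri 2 3 4; tri 3 5 6] [:: tri 2 3 6; tri 3 4 5];
   rel (tri 2 3 5) X_label [:: tri 1 2 5; tri 2 3 4; tri 3 5 6]
      [:: tri 1 2 3; tri 2 5 6; tri 3 4 5];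
   rel (tri 2 3 6) X_label [:: tri 1 2 6; tri 2 3 4; tri 3 5 6]
      [:: tri 1 2 3; tri 2 5 6; tri 3 4 6];
   rel (tri 2 4 5) (tri 3 4 6) [:: tri 2 3 4; tri 4 5 6] [:: tri 2 4 6; tri 3 4 5];
   rel (tri 2 4 5) (tri 3 5 6) [:: tri 2 3 5; tri 4 5 6] [:: tri 2 5 6; tri 3 4 5];
   rel (tri 2 4 5) X_label [:: tri 1 2 5; tri 2 3 4; tri 4 5 6]
      [:: tri 1 2 4; tri 2 5 6; tri 3 4 5];
   rel (tri 2 4 6) (tri 3 5 6) [:: tri 2 3 6; tri 4 5 6] [:: tri 2 5 6; tri 3 4 6];
   rel (tri 2 4 6) X_label [:: tri 1 2 6; tri 2 3 4; tri 4 5 6]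
      [:: tri 1 2 4; tri 2 5 6; tri 3 4 6];
   rel (tri 2 4 6) Y_label [:: tri 1 4 6; tri 2 3 6; tri 2 4 5]
      [:: tri 1 2 6; tri 2 3 4; tri 4 5 6];
   rel (tri 2 5 6) Y_label [:: tri 1 5 6; tri 2 3 6; tri 2 4 5]
      [:: tri 1 2 6; tri 2 3 5; tri 4 5 6];
   rel (tri 3 4 6) Y_label [:: tri 1 4 6; tri 2 3 6; tri 3 4 5]
      [:: tri 1 3 6; tri 2 3 4; tri 4 5 6];
   rel (tri 3 5 6) Y_label [:: tri 1 5 6; tri 2 3 6; tri 3 4 5]
      [:: tri 1 3 6; tri 2 3 5; tri 4 5 6] ].

(** Mutating back from z' to z changes the sign of the column, hence swaps the
    two monomials. *)
Definition flip (e : exchange) : exchange :=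
  ((ex_new e, ex_old e), (ex_neg e, ex_pos e)).

Definition exchanges := exchange_relations ++ map flip exchange_relations.

(** Two cluster variables lie in a common cluster unless they are exchanged for
    each other or form one of two exceptional pairs, which are too far apart to be
    joined by a single exchange. *)
Definition compatible (x y : label) : bool :=
  ~~ has (fun e => (ex_old e == x) && (ex_new e == y)) exchanges
  && ((x, y) \notin [:: (tri 1 3 5, tri 2 4 6); (tri 2 4 6, tri 1 3 5);
                        (X_label, Y_label); (Y_label, X_label)]).

(** Adding one label at a time yields every clique once, with its labels in the
    order of [mutable_labels]. *)
Definition cliques : seq (seq label) :=
  foldr (fun x Cs => Cs ++ [seq x :: C | C <- Cs & all (compatible x) C])
        [:: [::]] mutable_labels.

Definition clusters := [seq C <- cliques | size C == 4].

(** Default value: every label that is looked up belongs to the cluster. *)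
Definition no_exchange : exchange := (([::], [::]), ([::], [::])).

(** The label replacing z in C is the partner of z that is compatible with the
    remaining labels of C. *)
Definition exchange_of (C : seq label) (z : label) : exchange :=
  let from_z := [seq e <- exchanges | ex_old e == z] in
  head no_exchange [seq e <- from_z | all (compatible (ex_new e)) (rem z C)].

(** A seed is represented by the exchanges of its cluster variables, in the order
    of [mutable_labels]; cluster and matrix are both read off from them. *)
Definition model : Type := seq exchange.

Definition models : seq model :=
  [seq [seq exchange_of C z | z <- C] | C <- clusters].

Definition members (S : model) : seq label := map ex_old S.

Definition model_rows (S : model) : seq label := members S ++ frozen_labels.

Definition exchange_at (S : model) (z : label) : exchange :=
  nth no_exchange S (index z (members S)).

(** The exponent of l in the quotient of the two monomials of the exchange of z. *)
Definition model_mx (S : model) (l z : label) : int :=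
  let e := exchange_at S z in
  (count_mem l (ex_pos e))%:Z - (count_mem l (ex_neg e))%:Z.

Definition swap (z z' y : label) : label := if y == z then z' else y.

Definition is_model_of (C : seq label) (S : model) : bool :=
  members S == [seq l <- mutable_labels | l \in C].

Definition model_of (C : seq label) : model :=
  nth [::] models (find (is_model_of C) models).

Lemma model_of_mem (C : seq label) :
  has (is_model_of C) models -> model_of C \in models.
Proof. by move=> hasC; rewrite mem_nth // -has_find. Qed.

Definition mutated_members (S : model) (z : label) : seq label :=
  map (swap z (ex_new (exchange_at S z))) (members S).

Definition model_mutate (S : model) (z : label) : model :=
  model_of (mutated_members S z).

(** The matrix mutation rule, on matrices indexed by labels. *)
Definition mutated_entry (b : label -> label -> int) (z r y : label) : int :=
  if (r == z) || (y == z) then - b r y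
  else b r y + ((`|b r z| * b z y + b r z * `|b z y|) %/ 2)%Z.

(** The product formed by a mutation in direction z, over the rows selected by
    the sign condition, as a list of labels with repetitions. *)
Definition monomial (S : model) (sgn : pred int) (z : label) : seq label :=
  flatten [seq nseq `|model_mx S l z|%N l
          | l <- model_rows S & sgn (model_mx S l z)].

Definition well_formed (S : model) : bool :=
  [&& size S == 4, uniq (members S) & all (mem mutable_labels) (members S)].

(** What one mutation step needs: the exchange at z is a known relation, its two
    monomials are those computed from the matrix, and mutating the matrix gives the
    matrix that the new cluster prescribes. *)
Definition closed_at (S : model) (z : label) : bool :=
  let e := exchange_at S z in
  let f := swap z (ex_new e) in
  let T := model_mutate S z in
  [&& e \in exchanges, ex_old e == z, ex_new e \notin members S,
      has (is_model_of (mutated_members S z)) models,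
      all (mem (members T)) (mutated_members S z),
      perm_eq (monomial S (fun b => 0 < b) z) (ex_pos e),
      perm_eq (monomial S (fun b => b < 0) z) (ex_neg e) &
      all (fun r => all (fun y =>
          mutated_entry (model_mx S) z r y == model_mx T (f r) (f y))
        (members S)) (model_rows S)].

(** The pattern is finite: fifty seeds, four mutations each. *)
Lemma models_closed :
  all (fun S => well_formed S && all (closed_at S) (members S)) models.
Proof. by vm_compute. Qed.

Definition initial_model : model :=
  model_of [:: tri 1 3 6; tri 2 3 6; tri 3 4 6; tri 3 5 6].

(** The labels to be removed, one after the other.  Each of these twelve mutations
    introduces a label not met before; with the four initial ones this makes
    sixteen. *)
Definition walk : seq label :=
  [:: tri 3 5 6; tri 1 3 6; tri 1 4 6; tri 3 4 6; tri 2 4 6; tri 2 5 6;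
      tri 2 3 6; Y_label; tri 2 4 5; tri 2 3 5; tri 1 3 5; tri 1 4 5].

Fixpoint admissible (S : model) (zs : seq label) : bool :=
  if zs is z :: zs' then (z \in members S) && admissible (model_mutate S z) zs'
  else true.

Lemma walk_admissible : admissible initial_model walk.
Proof. by vm_compute. Qed.

Lemma walk_covers :
  all (fun l => has (fun S => l \in members S)
                    (initial_model :: scanl model_mutate initial_model walk))
      mutable_labels.
Proof. by vm_compute. Qed.

(** * The exchange relations as polynomial identities *)

Section LabelValues.
Variable R : comNzRingType.
Implicit Type m : nat -> nat -> R.

Definition det3 m (a b c : nat) : R :=
  m 0%N a * (m 1%N b * m 2%N c - m 1%N c * m 2%N b)
  - m 0%N b * (m 1%N a * m 2%N c - m 1%N c * m 2%N a)
  + m 0%N c * (m 1%N a * m 2%N b - m 1%N b * m 2%N a).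

Definition X_value m (a b c d e f : nat) : R :=
  det3 m a c d * det3 m b e f - det3 m a e f * det3 m b c d.

Definition label_value m (l : label) : R :=
  match l with
  | [:: a; b; c] => det3 m a b c
  | [:: a; b; c; d; e; f] => X_value m a b c d e f
  | _ => 0
  end.

(** Only finitely many entries matter; this absorbs the default values coming
    from the truncation of indices outside the matrix. *)
Lemma eq_label_value m m' (l : label) :
  (forall i a, (i < 3)%N -> a \in l -> m i a = m' i a) ->
  label_value m l = label_value m' l.
Proof.
case: l => [|a [|b [|c [|d [|e [|f [|g l]]]]]]] //= eq_m.
  by rewrite /det3 !eq_m ?inE ?eqxx ?orbT.
by rewrite /X_value /det3 !eq_m ?inE ?eqxx ?orbT.
Qed.

(** The three-term Pluecker relations and the relations involving X and Y: all are
    identities between polynomials in the entries of a 3 x 6 matrix. *)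
Lemma exchange_relations_value m :
  {in exchange_relations, forall e,
    label_value m (ex_old e) * label_value m (ex_new e) =
    \prod_(l <- ex_pos e) label_value m l + \prod_(l <- ex_neg e) label_value m l}.
Proof.
move=> e; rewrite /exchange_relations.
by do 52 (rewrite in_cons; case/predU1P => [-> | ];
  first by rewrite !(big_cons, big_nil) /= /X_value /det3; ring).
Qed.

Lemma exchange_value m :
  {in exchanges, forall e,
    label_value m (ex_old e) * label_value m (ex_new e) =
    \prod_(l <- ex_pos e) label_value m l + \prod_(l <- ex_neg e) label_value m l}.
Proof.
move=> e; rewrite mem_cat => /orP[/exchange_relations_value-> //|].
by case/mapP => e' /exchange_relations_value He' ->; rewrite mulrC He' addrC.
Qed.

End LabelValues.

Lemma label_value_rmorph (R S : comNzRingType) (phi : {rmorphism R -> S})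
    (m : nat -> nat -> R) (l : label) :
  label_value (fun i a => phi (m i a)) l = phi (label_value m l).
Proof.
case: l => [|a [|b [|c [|d [|e [|f [|g l]]]]]]] /=; rewrite ?rmorph0 //.
  by rewrite /det3 !(rmorphD, rmorphN, rmorphM).
by rewrite /X_value /det3 !(rmorphD, rmorphN, rmorphM).
Qed.

(** * Polynomials vanishing on a dense set *)

Section PolynomialFunctions.
Variable K : numFieldType.

Lemma poly_eq0_fun (p : {poly K}) : (forall t, p.[t] = 0) -> p = 0.
Proof.
move=> p0; apply/eqP; apply: contraT => nz_p.
pose s : seq K := [seq i%:R | i <- iota 0 (size p)].
have : (size s < size p)%N.
  apply: max_poly_roots => //; first by apply/allP => x _; apply/rootP.
  by rewrite map_inj_uniq ?iota_uniq // => i j /eqP; rewrite eqr_nat => /eqP.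
by rewrite size_map size_iota ltnn.
Qed.

(** The coefficient of X^m in p is found in the coefficient of degree m_n of p,
    seen as a polynomial in the last variable. *)
Lemma muni_inj n (R : comNzRingType) : injective (@muni n R).
Proof.
move=> p q eq_pq; apply/eqP; rewrite -subr_eq0; apply/eqP.
have: muni (p - q) = 0 by rewrite muniB eq_pq subrr.
move: (p - q) => {eq_pq} {}p p0; apply/mpolyP => m; rewrite mcoeff0.
have /(congr1 (fun u : {poly {mpoly R[n]}} =>
  (u`_(m ord_max))@_[multinom m (widen_ord (leqnSn n) i) | i < n])) := p0.
rewrite muniE coef_sum coef0 mcoeff0 raddf_sum /= => p0m.
have [mp|/memN_msupp_eq0//] := boolP (m \in msupp p).
rewrite -p0m (bigD1_seq m) //= coefZ coefXn eqxx mulr1 mcoeffZ mcoeffX eqxx.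
rewrite mulr1 big1 ?addr0 // => m' ne_m.
rewrite coefZ coefXn.
case: eqP => [eq_max|_]; last by rewrite mulr0 mcoeff0.
rewrite mulr1 mcoeffZ mcoeffX; case: eqP => [eq_m|_]; last by rewrite mulr0.
case/eqP: ne_m; apply/mnmP => i.
have [j ->|->] := unliftP ord_max i; last by rewrite eq_max.
have -> : lift ord_max j = widen_ord (leqnSn n) j.
  by apply/val_inj; rewrite /= /bump leqNgt ltn_ord.
by have /mnmP/(_ j) := eq_m; rewrite !mnmE.
Qed.

Lemma meval_muni n (p : {mpoly K[n.+1]}) (v : 'I_n.+1 -> K) :
  p.@[v] = (map_poly (meval (v \o widen_ord (leqnSn n))) (muni p)).[v ord_max].
Proof.
rewrite muniE rmorph_sum horner_sum mevalE; apply: eq_bigr => m _.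
rewrite /= -!mul_polyC rmorphM /= map_polyC map_polyXn hornerM hornerC.
rewrite hornerXn /= mevalZ mevalX -mulrA.
rewrite big_ord_recr /=; congr (_ * (_ * _)).
by apply: eq_bigr => i _; rewrite mnmE.
Qed.

(** Induction on the number of variables: fixing all but the last one leaves a
    univariate polynomial with infinitely many roots. *)
Lemma mpoly_eq0_fun n (p : {mpoly K[n]}) : (forall v, p.@[v] = 0) -> p = 0.
Proof.
elim: n p => [|n IHn] p p0.
  have pE : p = (p@_0)%:MP.
    apply/mpolyP => m; rewrite mcoeffC (_ : m = 0%MM) ?eqxx ?mulr1 //.
    by apply/mnmP => -[].
  by have := p0 (fun=> 0); rewrite pE mevalC => ->; rewrite mpolyC0.
apply: (@muni_inj n); rewrite muni0; apply/polyP => i; rewrite coef0.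
apply: IHn => w.
have /(congr1 (fun q : {poly K} => q`_i)) :
    map_poly (meval w) (muni p) = 0.
  apply: poly_eq0_fun => t.
  pose v j := if unlift ord_max j is Some j' then w j' else t.
  rewrite -[RHS](p0 v) meval_muni /v unlift_none; congr (_.[_]).
  apply: eq_map_poly => q; apply: meval_eq => j /=.
  have -> : widen_ord (leqnSn n) j = lift ord_max j.
    by apply/val_inj; rewrite /= /bump leqNgt ltn_ord.
  by rewrite liftK.
by rewrite coef_map coef0.
Qed.

(** The nonvanishing locus of q is Zariski dense, as p q vanishes everywhere. *)
Lemma mpoly_eq0_fun_dense n (p q : {mpoly K[n]}) :
  q != 0 -> (forall v, q.@[v] != 0 -> p.@[v] = 0) -> p = 0.
Proof.
move=> nz_q p0; have /eqP : p * q = 0.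
  apply: mpoly_eq0_fun => v; rewrite mevalM.
  by have [->|/p0->] := eqVneq q.@[v] 0; rewrite (mulr0, mul0r).
by rewrite mulf_eq0 (negPf nz_q) orbF => /eqP.
Qed.

End PolynomialFunctions.

(** * Regular functions and their fractions *)

Section Fractions.
Local Open Scope quotient_scope.

(** Fractions are classes of pairs; this recovers a numerator and a denominator. *)
Lemma fraction_quot (R : idomainType) (z : {fraction R}) :
  exists n d : R, d != 0 /\ z = tofrac n / tofrac d.
Proof.
elim/quotW: z => x; exists \n_x, \d_x; split; first exact: denom_ratioP.
have nz_d : tofrac \d_x != 0 by rewrite tofrac_eq0 denom_ratioP.
rewrite -[LHS](mulfK nz_d); congr (_ / _).
unlock FracField.tofrac; rewrite -[LHS]FracField.pi_mul; apply/eqmodP.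
rewrite /= FracField.equivfE /FracField.mulf.
by rewrite !numden_Ratio ?mulr1 ?oner_neq0 ?denom_ratioP //; apply/eqP/mulrC.
Qed.

End Fractions.

Section RegularFunctions.
Variables (K : numFieldType) (k n : nat).
Local Open Scope quotient_scope.
Local Notation N := #|{: ksubset k n}|.
Local Notation ring := (grass_ring K k n).
Local Notation field := (grass_field K k n).
Implicit Types (f g : ring) (M : 'M[K]_(k, n)).

(** [regular_at] with its arguments swapped, to carry a ring morphism structure. *)
Definition evaluation M f : K := regular_at f M.

Lemma evaluation_is_zmod M : zmod_morphism (evaluation M).
Proof.
move=> f g; rewrite /evaluation -[f]reprK -[g]reprK -rmorphB /=.
by rewrite !regular_at_pi mevalB.
Qed.

Lemma evaluation_is_monoid M : monoid_morphism (evaluation M).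
Proof.
rewrite /evaluation; split=> [|f g].
  by rewrite -(rmorph1 (\pi_(grass_ring K k n))) regular_at_pi meval1.
by rewrite -[f]reprK -[g]reprK -rmorphM /= !regular_at_pi mevalM.
Qed.

HB.instance Definition _ M := GRing.isZmodMorphism.Build ring K
  (evaluation M) (evaluation_is_zmod M).
HB.instance Definition _ M := GRing.isMonoidMorphism.Build ring K
  (evaluation M) (evaluation_is_monoid M).

(** The ideal of the cone is defined as the polynomials that vanish on it. *)
Lemma evaluation_inj f g : (forall M, evaluation M f = evaluation M g) -> f = g.
Proof.
move=> eq_fg; rewrite -[f]reprK -[g]reprK; apply/eqP.
rewrite -Quotient.idealrBE; apply/vanishing_idealP => M.
rewrite mevalB; apply/eqP; rewrite subr_eq0; apply/eqP.
exact: eq_fg.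
Qed.

(** [scalar_frac] before passing to fractions, so that polynomial expressions can
    be compared inside the ring of regular functions. *)
Definition scalar_fun (c : K) : ring := \pi_ring c%:MP.

Lemma scalar_fun_is_zmod : zmod_morphism scalar_fun.
Proof. by move=> a b; rewrite /scalar_fun mpolyCB rmorphB. Qed.

Lemma scalar_fun_is_monoid : monoid_morphism scalar_fun.
Proof.
by split=> [|a b]; rewrite /scalar_fun ?rmorph1 // mpolyCM rmorphM.
Qed.

HB.instance Definition _ :=
  GRing.isZmodMorphism.Build K ring scalar_fun scalar_fun_is_zmod.
HB.instance Definition _ :=
  GRing.isMonoidMorphism.Build K ring scalar_fun scalar_fun_is_monoid.

Lemma evaluation_scalar c M : evaluation M (scalar_fun c) = c.
Proof. by rewrite /evaluation regular_at_pi mevalC. Qed.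

HB.instance Definition _ :=
  GRing.isZmodMorphism.Build ring field (@regular_frac K k n)
    (@tofrac_is_zmod_morphism ring).
HB.instance Definition _ :=
  GRing.isMonoidMorphism.Build ring field (@regular_frac K k n)
    (@tofrac_is_monoid_morphism ring).

Lemma regular_frac_inj : injective (@regular_frac K k n).
Proof. by move=> f g /eqP; rewrite tofrac_eq => /eqP. Qed.

Lemma mmap_regular_frac m (g : 'I_m -> ring) (P : {mpoly K[m]}) :
  mmap (@scalar_frac K k n) (fun a => regular_frac (g a)) P
  = regular_frac (mmap scalar_fun g P).
Proof.
rewrite rmorph_sum; apply: eq_bigr => u _; rewrite rmorphM; congr (_ * _).
by rewrite rmorph_prod; apply: eq_bigr => i _; rewrite rmorphXn.
Qed.

Lemma evaluation_mmap m (g : 'I_m -> ring) (P : {mpoly K[m]}) M :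
  evaluation M (mmap scalar_fun g P) = P.@[fun a => evaluation M (g a)].
Proof.
rewrite mevalE (rmorph_sum (evaluation M)); apply: eq_bigr => u _.
rewrite rmorphM /= evaluation_scalar; congr (_ * _).
by rewrite rmorph_prod; apply: eq_bigr => i _; rewrite rmorphXn.
Qed.

Lemma Delta_val (A : ksubset k n) :
  Delta K k (val A) = \pi_ring 'X_(enum_rank A).
Proof. by rewrite /Delta valK. Qed.

Lemma evaluation_Delta (A : ksubset k n) M :
  evaluation M (Delta K k (val A)) = minor M A.
Proof. by rewrite Delta_val /evaluation regular_at_pi mevalXU /pluecker enum_rankK. Qed.

(** The polynomial representing f, evaluated at the Pluecker coordinates. *)
Lemma Delta_generate f :
  f = mmap scalar_fun (fun a : 'I_N => Delta K k (val (enum_val a))) (repr f).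
Proof.
apply: evaluation_inj => M; rewrite evaluation_mmap.
by apply: meval_eq => a; rewrite evaluation_Delta.
Qed.

End RegularFunctions.

(** * Subsets of {1, ..., n} as increasing sequences *)

Section SetLabels.
Variable n : nat.
Implicit Types (A : {set 'I_n}) (s : label).

(** The inverse of [labelled] on increasing sequences: it reduces questions about
    sets of ordinals to computations with lists. *)
Definition set_label A : label := [seq (val a).+1 | a <- enum A].

Definition is_label s := sorted ltn s && all (fun a => 0 < a <= n)%N s.

Lemma set_labelK A : labelled n (set_label A) = A.
Proof.
apply/setP => a; rewrite inE; apply/mapP/idP => [[b]|Aa].
  by rewrite mem_enum => Ab [/val_inj ->].
by exists a; rewrite ?mem_enum.
Qed.

Lemma set_label_inj : injective set_label.
Proof. exact: can_inj set_labelK. Qed.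

Lemma enum_sorted A : sorted ltn [seq val a | a <- enum A].
Proof.
rewrite sorted_map sorted_filter //; first by move=> a b c; apply: ltn_trans.
by rewrite -enumT -sorted_map val_enum_ord iota_ltn_sorted.
Qed.

Lemma set_label_is_label A : is_label (set_label A).
Proof.
apply/andP; split; last by apply/allP => _ /mapP[a _ ->] /=.
by rewrite /set_label (map_comp succn val) (homo_sorted (e := ltn)) ?enum_sorted.
Qed.

Lemma is_label_eq s t : is_label s -> is_label t -> s =i t -> s = t.
Proof.
move=> /andP[s_sorted _] /andP[t_sorted _].
exact: (irr_sorted_eq ltn_trans ltnn).
Qed.

Lemma labelledK s : is_label s -> set_label (labelled n s) = s.
Proof.
move=> s_lab; apply: is_label_eq (set_label_is_label _) (s_lab) _ => a.
apply/mapP/idP => [[b]|sa]; first by rewrite mem_enum inE => sb ->.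
have /andP[_ /allP/(_ a sa)/andP[a_gt0 a_le]] := s_lab.
have ltan : (a.-1 < n)%N by rewrite prednK.
by exists (Ordinal ltan); rewrite /= ?mem_enum ?inE /= prednK.
Qed.

Lemma size_set_label A : size (set_label A) = #|A|.
Proof. by rewrite size_map cardE. Qed.

Lemma set_labelE A (P : pred nat) :
  (forall a : 'I_n, (a \in A) = P a.+1) -> set_label A = [seq a <- iota 1 n | P a].
Proof.
move=> AP; have filter_lab : is_label [seq a <- iota 1 n | P a].
  rewrite /is_label sorted_filter ?iota_ltn_sorted //; last exact: ltn_trans.
  by apply/allP => a; rewrite mem_filter mem_iota add1n ltnS => /andP[].
apply: is_label_eq (set_label_is_label _) filter_lab _ => a.
rewrite mem_filter mem_iota add1n ltnS; apply/mapP/and3P => [[b]|[Pa a_gt0 a_le]].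
  by rewrite mem_enum AP => Pb ->; split=> //; apply: ltn_ord.
have ltan : (a.-1 < n)%N by rewrite prednK.
by exists (Ordinal ltan); rewrite /= ?mem_enum ?AP /= prednK.
Qed.

Definition arc_mem (p : int) (l a : nat) : bool :=
  has (fun t => (a%:Z == p + t%:Z %[mod n%:Z])%Z) (iota 0 l).

Lemma in_cyclic_arc p l (a : 'I_n) : (a \in cyclic_arc n p l) = arc_mem p l a.+1.
Proof.
rewrite inE; apply/existsP/hasP => [[t eq_a]|[t]].
  by exists (val t); rewrite // mem_iota add0n ltn_ord.
by rewrite mem_iota add0n => lt_t eq_a; exists (Ordinal lt_t).
Qed.

Definition arc_label (p : int) (l : nat) : label :=
  [seq a <- iota 1 n | arc_mem p l a].

Lemma set_label_arc p l : set_label (cyclic_arc n p l) = arc_label p l.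
Proof. exact/set_labelE/in_cyclic_arc. Qed.

Lemma cyclic_intervalE k A :
  cyclic_interval k A =
  (set_label A \in [seq arc_label a.+1%:Z k | a <- iota 0 n]).
Proof.
apply/existsP/mapP => [[a /eqP->]|[a]].
  by exists (val a); rewrite ?set_label_arc // mem_iota add0n ltn_ord.
rewrite mem_iota add0n => lt_a; rewrite -set_label_arc => /set_label_inj ->.
by exists (Ordinal lt_a); apply/eqP.
Qed.

Definition I_label k (i j : nat) : label :=
  [seq a <- iota 1 n | arc_mem (p_start k n i j) i a
                       || arc_mem (p'_start k n i j) (k - i) a].

Lemma set_label_Iset k i j : set_label (Iset k n i j) = I_label k i j.
Proof. by apply: set_labelE => a; rewrite inE !in_cyclic_arc. Qed.

Lemma ksubset_nth_label k (A : ksubset k n) (t : 'I_k) :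
  (ksubset_nth A t).+1 = nth 0%N (set_label (val A)) t.
Proof.
rewrite (nth_map (ksubset_nth A t)); last first.
  by rewrite -cardE (eqP (valP A)).
by rewrite /ksubset_nth [in LHS](enum_val_nth (ksubset_nth A t)).
Qed.

End SetLabels.

(** Exhaustion of the twenty increasing triples. *)
Lemma label_of_3subset (A : {set 'I_6}) :
  #|A| = 3%N -> set_label A \in frozen_labels ++ internal_labels.
Proof.
move=> cardA; have := set_label_is_label A; rewrite -size_set_label in cardA.
move: (set_label A) cardA => [|a [|b [|c []]]] //= _ /andP[] /=.
rewrite !andbT => /andP[ltab ltbc] /and3P[/andP[a0 a6] /andP[b0 b6] /andP[c0 c6]].
have : all (fun a => all (fun b => all (fun c => (a < b < c)%N ==>
    ([:: a; b; c] \in frozen_labels ++ internal_labels)) (iota 1 6)) (iota 1 6))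
    (iota 1 6) by vm_compute.
have in_iota x : (0 < x -> x <= 6 -> x \in iota 1 6)%N.
  by move=> x0 x6; rewrite mem_iota x0.
move/allP/(_ a (in_iota _ a0 a6))/allP/(_ b (in_iota _ b0 b6)).
by move/allP/(_ c (in_iota _ c0 c6)); rewrite ltab ltbc.
Qed.

(** The six cyclic intervals, computed. *)
Lemma cyclic_interval_frozen (A : {set 'I_6}) :
  cyclic_interval 3 A = (set_label A \in frozen_labels).
Proof. by rewrite cyclic_intervalE; apply: (congr1 (fun s => _ \in s)); vm_compute. Qed.

Lemma internalE (A : {set 'I_6}) :
  (A \in internal 3 6) = (set_label A \in internal_labels).
Proof.
rewrite inE cyclic_interval_frozen; apply/andP/idP => [[/eqP cardA]|intA].
  by have := label_of_3subset cardA; rewrite mem_cat => /orP[->|].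
have : all (fun l => (size l == 3) && (l \notin frozen_labels)) internal_labels.
  by vm_compute.
by move/allP/(_ _ intA); rewrite size_set_label => /andP[].
Qed.

Lemma enum_internal :
  perm_eq [seq set_label A | A <- enum (internal 3 6)] internal_labels.
Proof.
apply: uniq_perm => [||l].
- by rewrite map_inj_uniq ?enum_uniq //; apply: set_label_inj.
- by vm_compute.
apply/mapP/idP => [[A]|int_l]; first by rewrite mem_enum internalE => intA ->.
have lab_l : is_label 6 l.
  have : all (is_label 6) internal_labels by vm_compute.
  by move/allP/(_ _ int_l).
by exists (labelled 6 l); rewrite ?labelledK // mem_enum internalE labelledK.
Qed.

Lemma card_internal : #|internal 3 6| = 14%N.
Proof. by rewrite cardE -(size_map (@set_label 6)) (perm_size enum_internal). Qed.

(** * Labels as regular functions *)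

Lemma det_matrix3 (R : comNzRingType) (m : nat -> nat -> R) :
  \det (\matrix_(i < 3, j < 3) m i j) = det3 m 0 1 2.
Proof.
rewrite (expand_det_row _ ord0) !big_ord_recl big_ord0 /cofactor.
rewrite !(expand_det_row _ (ord0 : 'I_2)) !big_ord_recl !big_ord0 /cofactor.
rewrite !det_mx11 !mxE /= /bump /= !(expr0, expr1, addn0, add0n, addn1).
by rewrite /det3; ring.
Qed.

Lemma label_range : {in mutable_labels ++ frozen_labels, forall l a,
  a \in l -> (0 < a <= 6)%N}.
Proof.
have : all (all (fun a => 0 < a <= 6)%N) (mutable_labels ++ frozen_labels).
  by vm_compute.
by move=> /allP range_l l /range_l/allP.
Qed.

Section LabelFunctions.
Variable K : numFieldType.
Local Notation ring := (grass_ring K 3 6).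
Local Notation field := (grass_field K 3 6).

(** Column a of the matrix is column a - 1 counted from zero. *)
Definition entries (M : 'M[K]_(3, 6)) (i a : nat) : K :=
  M (inord i) (inord a.-1).

Definition label_fun (l : label) : ring :=
  if l == X_label then X123456 K
  else if l == Y_label then Y123456 K
  else Delta K 3 (labelled 6 l).

Lemma evaluation_Delta3 (M : 'M[K]_(3, 6)) (a b c : nat) :
  is_label 6 [:: a; b; c] ->
  evaluation M (Delta K 3 (labelled 6 [:: a; b; c])) = det3 (entries M) a b c.
Proof.
move=> lab_l; have cardA : #|labelled 6 [:: a; b; c]| == 3.
  by rewrite -size_set_label labelledK.
pose A : ksubset 3 6 := Sub (labelled 6 [:: a; b; c]) cardA.
rewrite -[labelled 6 _]/(val A) evaluation_Delta /minor.
rewrite -[RHS](det_matrix3 (fun i t => entries M i (nth 0%N [:: a; b; c] t))).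
congr (\det _); apply/matrixP => i t; rewrite !mxE /entries inord_val.
by rewrite -(labelledK lab_l) -(ksubset_nth_label A) /= inord_val.
Qed.

Lemma evaluation_label_fun (M : 'M[K]_(3, 6)) :
  {in mutable_labels ++ frozen_labels, forall l,
    evaluation M (label_fun l) = label_value (entries M) l}.
Proof.
move=> l lab_l; rewrite /label_fun.
have [->|neX] := eqVneq l X_label.
  by rewrite /X123456 rmorphB !rmorphM /= !evaluation_Delta3.
have [->|neY] := eqVneq l Y_label.
  rewrite /Y123456 rmorphB !rmorphM /= !evaluation_Delta3 //.
  by rewrite /X_value /det3; ring.
have : all (fun l => [|| l == X_label, l == Y_label | (size l == 3) && is_label 6 l])
    (mutable_labels ++ frozen_labels) by vm_compute.
move/allP/(_ _ lab_l); rewrite (negPf neX) (negPf neY) /=.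
by case: l {lab_l neX neY} => [|a [|b [|c []]]] //= /evaluation_Delta3.
Qed.

Lemma label_fun_Delta (l : label) :
  size l = 3%N -> label_fun l = Delta K 3 (labelled 6 l).
Proof.
move=> sz3; rewrite /label_fun.
case: eqP => [l_eq|_]; first by rewrite l_eq in sz3.
by case: eqP => [l_eq|_]; first by rewrite l_eq in sz3.
Qed.

Definition label_var (l : label) : field := regular_frac (label_fun l).

Lemma label_var_exchange : {in exchanges, forall e,
   label_var (ex_old e) * label_var (ex_new e) =
   \prod_(l <- ex_pos e) label_var l + \prod_(l <- ex_neg e) label_var l}.
Proof.
move=> e ex_e; have : all (fun e => all (mem (mutable_labels ++ frozen_labels))
   (ex_old e :: ex_new e :: ex_pos e ++ ex_neg e)) exchanges by vm_compute.
move/allP/(_ _ ex_e); rewrite /= all_cat.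
case/and4P=> [old_l new_l /allP pos_l /allP neg_l].
rewrite /label_var -rmorphM -!rmorph_prod -rmorphD; congr regular_frac.
apply: evaluation_inj => M; rewrite rmorphM rmorphD !rmorph_prod /=.
rewrite !evaluation_label_fun // exchange_value //.
by congr (_ + _); apply: eq_big_seq => l in_l; rewrite evaluation_label_fun //;
   [apply: pos_l|apply: neg_l].
Qed.

Lemma label_value_entries (m : nat -> nat -> K) :
  {in mutable_labels ++ frozen_labels, forall l,
    label_value (entries (\matrix_(i, a) m i a.+1)) l = label_value m l}.
Proof.
move=> l lP; apply: eq_label_value => i a lt_i l_a.
have /andP[a_gt0 a_le6] := label_range lP l_a.
by rewrite /entries mxE !inordK ?prednK.
Qed.

(** A matrix on which the sixteen functions take distinct nonzero values, kept
    small to ease the computation.  It shows at once that they are nonzero and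
    distinct over every field of characteristic zero. *)
Definition test_entry (i a : nat) : int :=
  nth 0%N (nth [::] [:: [:: 1; 1; 1; 1; 1; 1];
                        [:: 0; 1; 2; 3; 4; 5];
                        [:: 0; 5; 3; 0; 3; 2]] i) a.-1.

Lemma test_values : let values := [seq label_value test_entry l | l <- mutable_labels] in
  uniq values && (0 \notin values).
Proof. by vm_compute. Qed.

Definition test_matrix : 'M[K]_(3, 6) := \matrix_(i, a) (test_entry i a.+1)%:~R.

Lemma evaluation_test_matrix : {in mutable_labels, forall l,
  evaluation test_matrix (label_fun l) = (label_value test_entry l)%:~R}.
Proof.
move=> l lP; have lP' : l \in mutable_labels ++ frozen_labels.
  by rewrite (mem_cat l mutable_labels) lP.
rewrite evaluation_label_fun //.
rewrite (label_value_entries (fun i a => (test_entry i a)%:~R)) //.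
exact: (label_value_rmorph (intr : {rmorphism int -> K})).
Qed.

Lemma label_var_neq0 : {in mutable_labels, forall l, label_var l != 0}.
Proof.
move=> l lP; rewrite /label_var; apply: contraTneq (test_values).
rewrite -(rmorph0 (@regular_frac K 3 6)) => /regular_frac_inj l0.
rewrite negb_and negbK; apply/orP; right; apply/mapP; exists l => //.
have := evaluation_test_matrix lP; rewrite l0 rmorph0 => /esym/eqP.
by rewrite intr_eq0 => /eqP.
Qed.

Lemma label_var_inj : {in mutable_labels &, injective label_var}.
Proof.
move=> l l' lP lP' /regular_frac_inj eq_l.
have /andP[uniq_values _] := test_values.
have eq_value : label_value test_entry l = label_value test_entry l'.
  apply: (@intr_inj K); rewrite -!evaluation_test_matrix //.
  by congr evaluation.
have uniq_nth := uniqP 0 uniq_values.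
have val_nth i : (i < size mutable_labels)%N ->
    nth 0 [seq label_value test_entry l | l <- mutable_labels] i
    = label_value test_entry (nth [::] mutable_labels i).
  by move=> lt_i; rewrite (nth_map [::]).
rewrite -(nth_index [::] lP) -(nth_index [::] lP'); congr nth.
apply: uniq_nth; rewrite ?inE ?size_map ?index_mem //.
by rewrite !val_nth ?index_mem // !nth_index.
Qed.

End LabelFunctions.

(** * Seeds represented by model seeds *)

Lemma label_disjoint : {in mutable_labels, forall l, l \notin frozen_labels}.
Proof. by apply/allP; vm_compute. Qed.

Section Representation.
Variable K : numFieldType.
Local Notation field := (grass_field K 3 6).
Local Notation I := (mutable_index 3 6).
Local Notation J := (frozen_index 3 6).
Implicit Types (S : model) (g : I -> label) (s : seed field I J).

Definition row_label g (r : I + J) : label :=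
  match r with inl i => g i | inr A => set_label (val A) end.

(** In s a new variable takes the place of the old one, whereas S keeps its labels
    sorted; the injection g records which label stands at which place of s. *)
Definition represents S g s : Prop :=
  [/\ S \in models, injective g, forall i, g i \in members S,
      forall r, seed_var s r = label_var K (row_label g r)
    & forall r y, seed_mx s r y = model_mx S (row_label g r) (g y)].

Lemma modelP S : S \in models ->
  [/\ size (members S) = 4%N, uniq (members S),
      {subset members S <= mutable_labels} & {in members S, forall z, closed_at S z}].
Proof.
move=> S_model; have /allP/(_ _ S_model) := models_closed.
case/andP=> /and3P[/eqP szS uniqS /allP subS] /allP closedS.
by split; rewrite ?size_map.
Qed.

Lemma frozen_row_label (A : J) : set_label (val A) \in frozen_labels.
Proof. by rewrite -cyclic_interval_frozen (valP A). Qed.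

Lemma row_label_inj S g : S \in models -> injective g ->
  (forall i, g i \in members S) -> injective (row_label g).
Proof.
move=> /modelP[_ _ subS _] g_inj gS.
have ne i (A : J) : g i <> set_label (val A).
  by move=> eq_g; have := label_disjoint (subS _ (gS i)); rewrite eq_g frozen_row_label.
case=> [i|A] [j|B] /= eq_l.
- by rewrite (g_inj _ _ eq_l).
- by case: (ne _ _ eq_l).
- by case: (ne _ _ (esym eq_l)).
- by congr inr; apply/val_inj/set_label_inj.
Qed.

Lemma row_label_mem S g r :
  (forall i, g i \in members S) -> row_label g r \in model_rows S.
Proof.
move=> gS; rewrite mem_cat; apply/orP.
by case: r => [i|A]; [left; apply: gS | right; apply: frozen_row_label].
Qed.

Lemma model_rows_sub S :
  S \in models -> {subset model_rows S <= mutable_labels ++ frozen_labels}.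
Proof.
case/modelP=> _ _ subS _ l; rewrite !(mem_cat l) => /orP[/subS lP|lP].
  by rewrite -mem_cat lP.
by rewrite lP orbT.
Qed.

Lemma members_surj S g : S \in models -> injective g ->
  (forall i, g i \in members S) -> forall l, l \in members S -> exists i, l = g i.
Proof.
move=> /modelP[szS _ _ _] g_inj gS l lS.
have [|||_ memg] := @uniq_min_size _ (codom g) (members S).
- by rewrite map_inj_uniq ?enum_uniq.
- by move=> _ /codomP[i ->].
- by rewrite szS size_codom card_prod !card_ord.
by move: lS; rewrite -memg => /codomP.
Qed.

(** The rows of a seed are indexed by I + J and those of its model by labels; this
    identifies products over the two index sets. *)
Lemma row_label_perm S g : S \in models -> injective g ->
  (forall i, g i \in members S) ->
  perm_eq [seq row_label g r | r <- index_enum (I + J)%type] (model_rows S).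
Proof.
move=> S_model g_inj gS; have [_ uniqS subS _] := modelP S_model.
apply: uniq_perm => [||l].
- by rewrite map_inj_uniq ?index_enum_uniq //; apply: row_label_inj gS.
- rewrite cat_uniq; apply/and3P; split; [by [] | | by vm_compute].
  by apply/hasPn => l frl; apply: contraL frl => /subS/label_disjoint.
rewrite mem_cat; apply/mapP/orP => [[[i|A] _ ->]|[lS|frl]].
- by left; apply: gS.
- by right; apply: frozen_row_label.
- have [i ->] := members_surj S_model g_inj gS lS.
  by exists (inl i); rewrite ?mem_index_enum.
have lab_l : is_label 6 l.
  have : all (is_label 6) frozen_labels by vm_compute.
  by move/allP/(_ _ frl).
have cycA : cyclic_interval 3 (labelled 6 l).
  by rewrite cyclic_interval_frozen labelledK.
exists (inr (Sub (labelled 6 l) cycA)); rewrite ?mem_index_enum //=.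
by rewrite labelledK.
Qed.

Lemma monomial_row S g s (sgn : pred int) (z : I) : represents S g s ->
  \prod_(r | sgn (seed_mx s r z)) seed_var s r ^+ `|seed_mx s r z|%N
  = \prod_(l <- monomial S sgn (g z)) label_var K l.
Proof.
case=> S_model g_inj gS s_var s_mx; rewrite big_flatten big_map big_filter.
rewrite -(perm_big _ (row_label_perm S_model g_inj gS)) big_map /=.
apply: eq_big => [r|r _]; first by rewrite s_mx.
by rewrite s_mx s_var big_nseq iter_mulr_1.
Qed.

(** Mutation commutes with the representation.  The matrix part is the check in
    [closed_at]; for the new variable, the numerator of its definition is z z' by
    the exchange relation, and z is not zero. *)
Lemma represents_mutate S g s (z : I) : represents S g s ->
  let g' i := swap (g z) (ex_new (exchange_at S (g z))) (g i) in
  represents (model_mutate S (g z)) g' (mutate s z).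
Proof.
move=> rep_s g'; have [S_model g_inj gS s_var s_mx] := rep_s.
have [szS uniqS subS closedS] := modelP S_model.
have /and5P[ex_e old_e new_e hasT /and4P[subT pos_e neg_e mxT]] := closedS _ (gS z).
have f_inj := row_label_inj S_model g_inj gS.
set e := exchange_at S (g z) in ex_e old_e new_e subT pos_e neg_e mxT g' *.
have frozen_ne (A : J) : (set_label (val A) == g z) = false.
  by rewrite -[LHS]/(row_label g (inr A) == row_label g (inl z)) (inj_eq f_inj).
have row_g' r : row_label g' r = swap (g z) (ex_new e) (row_label g r).
  by case: r => [i|A] //=; rewrite /swap frozen_ne.
have row_eq r : (r == inl z) = (row_label g r == g z).
  by rewrite -[g z]/(row_label g (inl z)) (inj_eq f_inj).
have rows_f r := row_label_mem r gS.
split=> /=.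
- exact: model_of_mem.
- move=> i j; rewrite /g' /swap.
  case: eqP => [eq_i|_]; case: eqP => [eq_j|_] eq_g.
  + by apply: g_inj; rewrite eq_i eq_j.
  + by rewrite eq_g gS in new_e.
  + by rewrite -eq_g gS in new_e.
  + exact: g_inj.
- by move=> i; apply: (allP subT); apply: map_f; apply: gS.
- move=> r; rewrite row_g' row_eq /swap; case: eqP => [_|_]; last exact: s_var.
  rewrite /mutate_var (monomial_row (fun b => 0 < b) z rep_s).
  rewrite (monomial_row (fun b => b < 0) z rep_s).
  rewrite (perm_big _ pos_e) (perm_big _ neg_e) /= s_var /=.
  rewrite -label_var_exchange // (eqP old_e) mulrC mulKf //.
  exact/label_var_neq0/subS.
move=> r y; rewrite row_g' /g'.
have /allP/(_ _ (rows_f r))/allP/(_ _ (gS y))/eqP <- := mxT.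
by rewrite /mutate_mx /mutated_entry row_eq (inj_eq g_inj) !s_mx.
Qed.

Definition initial_label (u : I) : label := I_label 6 3 u.1.+1 u.2.+1.

(** The initial matrix, with the sets I_{ij} replaced by labels. *)
Definition initial_entry (l : label) (i j : nat) : int :=
  if l \in [:: I_label 6 3 i.-1 j; I_label 6 3 i.+1 j] then (-1) ^+ (i + j)
  else if l \in [:: I_label 6 3 i j.-1; I_label 6 3 i j.+1] then - (-1) ^+ (i + j)
  else 0.

Lemma initial_model_mx :
  [/\ initial_model \in models,
      {in [:: 1; 2] & [:: 1; 2], forall i j, {in [:: 1; 2] & [:: 1; 2],
        forall i' j', I_label 6 3 i j = I_label 6 3 i' j' -> (i, j) = (i', j')}}%N,
      {in [:: 1; 2] &, forall i j, I_label 6 3 i j \in members initial_model}%N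
    & {in model_rows initial_model & [:: 1; 2]%N, forall l i,
        {in [:: 1; 2]%N, forall j,
         initial_entry l i j = model_mx initial_model l (I_label 6 3 i j)}}].
Proof.
split.
- by apply: model_of_mem; vm_compute.
- move=> i j iP jP i' j' iP' jP' eq_l; apply/eqP.
  have : all (fun i => all (fun j => all (fun i' => all (fun j' =>
    (I_label 6 3 i j == I_label 6 3 i' j') ==> ((i, j) == (i', j')))
    [:: 1; 2]) [:: 1; 2]) [:: 1; 2]) [:: 1; 2]%N by vm_compute.
  move/allP/(_ i iP)/allP/(_ j jP)/allP/(_ i' iP')/allP/(_ j' jP')/implyP.
  by apply; apply/eqP.
- move=> i j iP jP.
  have : all (fun i => all (fun j =>
    I_label 6 3 i j \in members initial_model) [:: 1; 2]%N) [:: 1; 2]%N by vm_compute.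
  by move/allP/(_ i iP)/allP/(_ j jP).
have : all (fun l => all (fun i => all (fun j =>
  initial_entry l i j == model_mx initial_model l (I_label 6 3 i j)) [:: 1; 2]%N)
   [:: 1; 2]%N) (model_rows initial_model) by vm_compute.
move/allP=> mxI l i lS iP j jP.
by have /allP/(_ i iP)/allP/(_ j jP)/eqP := mxI l lS.
Qed.

Lemma initial_row_size l : l \in model_rows initial_model -> size l = 3%N.
Proof.
have : all (fun l => size l == 3) (model_rows initial_model) by vm_compute.
by move/allP => row3 /row3/eqP.
Qed.

Lemma represents_initial :
  represents initial_model initial_label (initial_seed K 3 6).
Proof.
have [S_model injI subI mxI] := initial_model_mx.
have in12 (i : 'I_2) : i.+1 \in [:: 1; 2]%N by case: i => [[|[]]].
have row_set_label r : set_label (row_set r) = row_label initial_label r.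
  by case: r => [u|A]; [apply: set_label_Iset | ].
have gS u : initial_label u \in members initial_model by apply: subI; apply: in12.
have rowS r := row_label_mem r gS.
split; [exact: S_model | | exact: gS | | ].
- move=> [i j] [i' j'] /(injI _ _ (in12 i) (in12 j) _ _ (in12 i') (in12 j')).
  by case=> eq_i eq_j; congr pair; apply/val_inj.
- move=> r; rewrite /label_var (label_fun_Delta _ (initial_row_size (rowS r))).
  by rewrite -row_set_label set_labelK.
move=> r u; rewrite [RHS](_ : _ = initial_entry (row_label initial_label r)
    u.1.+1 u.2.+1); last by rewrite -(mxI _ _ (rowS r) (in12 u.1) _ (in12 u.2)).
rewrite /initial_entry -row_set_label -!set_label_Iset /= /initial_mx !inE.
by rewrite !(inj_eq (@set_label_inj _)).
Qed.

(** A path of model mutations lifts to a path of seeds. *)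
Lemma walk_represented s0 S g s zs T :
  mutation_equiv s0 s -> represents S g s -> admissible S zs ->
  T \in S :: scanl model_mutate S zs ->
  exists g' s', mutation_equiv s0 s' /\ represents T g' s'.
Proof.
elim: zs S g s => [|z zs IHzs] S g s s0s rep_s /=.
  by rewrite inE => _ /eqP->; exists g, s.
case/andP=> zS adm; rewrite in_cons => /predU1P[->|inT]; first by exists g, s.
have [S_model g_inj gS _ _] := rep_s.
have [i def_z] := members_surj S_model g_inj gS zS.
rewrite def_z in adm inT.
apply: IHzs (represents_mutate i rep_s) adm inT.
exact: mutation_step.
Qed.

Lemma mutation_equiv_represented s :
  mutation_equiv (initial_seed K 3 6) s -> exists S g, represents S g s.
Proof.
elim=> [|{}s z _ [S [g rep_s]]].
  by exists initial_model, initial_label; apply: represents_initial.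
by eexists; eexists; apply: represents_mutate rep_s.
Qed.

(** From left to right, every seed is represented by a model, whose labels are
    among the sixteen; from right to left, the walk reaches each label. *)
Lemma cluster_variableP (x : field) :
  cluster_variable (initial_seed K 3 6) x <->
  exists2 l, l \in mutable_labels & x = label_var K l.
Proof.
split=> [[s /mutation_equiv_represented[S [g rep_s]] [i ->]]|[l lP ->]].
  have [S_model _ gS s_var _] := rep_s; have [_ _ subS _] := modelP S_model.
  by exists (g i); [apply: subS | rewrite s_var].
have /allP/(_ _ lP)/hasP[S inS lS] := walk_covers.
have [g [s [s0s [S_model g_inj gS s_var _]]]] := walk_represented
  (mutation_refl _) represents_initial walk_admissible inS.
exists s; first exact: s0s.
have [i ->] := members_surj S_model g_inj gS lS.
by exists i; rewrite [RHS]s_var.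
Qed.

End Representation.

(** * Rational closure and prescribed minors *)

Section RationalClosure.
Variables (K F : fieldType) (iota : {rmorphism K -> F}) (L : finType) (x : L -> F).
Local Notation ev := (mmap iota (x \o (enum_val : 'I_#|L| -> L))).

(** Membership in the subfield K(x) of F, as a quotient of two polynomials in x. *)
Definition rational_over (z : F) : Prop :=
  exists p q : {mpoly K[#|L|]}, ev q != 0 /\ z = ev p / ev q.

Lemma rational_ev p : rational_over (ev p).
Proof. by exists p, 1; rewrite rmorph1 oner_neq0 divr1. Qed.

Lemma rational_gen r : rational_over (x r).
Proof.
by have := rational_ev 'X_(enum_rank r); rewrite mmapX mmap1U /= enum_rankK.
Qed.

Lemma rational_scalar c : rational_over (iota c).
Proof. by rewrite -(mmapC (x \o (enum_val : 'I_#|L| -> L))); apply: rational_ev. Qed.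

Lemma rational1 : rational_over 1.
Proof. by rewrite -(rmorph1 iota); apply: rational_scalar. Qed.

Lemma rationalD y z : rational_over y -> rational_over z -> rational_over (y + z).
Proof.
move=> [p [q [nz_q ->]]] [p' [q' [nz_q' ->]]].
exists (p * q' + p' * q), (q * q').
by rewrite rmorphD !rmorphM mulf_neq0 // addf_div.
Qed.

Lemma rationalM y z : rational_over y -> rational_over z -> rational_over (y * z).
Proof.
move=> [p [q [nz_q ->]]] [p' [q' [nz_q' ->]]].
by exists (p * p'), (q * q'); rewrite !rmorphM mulf_neq0 // mulf_div.
Qed.

Lemma rationalV z : rational_over z -> rational_over z^-1.
Proof.
move=> [p [q [nz_q ->]]]; rewrite invf_div.
have [->|nz_p] := eqVneq (ev p) 0; last by exists q, p.
by rewrite invr0 mulr0 -(rmorph0 iota); apply: rational_scalar.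
Qed.

Lemma rational_prod_exp (T : Type) (s : seq T) (P : pred T) (f : T -> F) (e : T -> nat) :
  (forall t, rational_over (f t)) -> rational_over (\prod_(t <- s | P t) f t ^+ e t).
Proof.
move=> rat_f; apply: big_ind => [|y z|t _]; [exact: rational1 | exact: rationalM |].
by elim: (e t) => [|n IHn]; [exact: rational1 | rewrite exprS; apply: rationalM].
Qed.

Lemma rational_mmap n (h : 'I_n -> F) (p : {mpoly K[n]}) :
  (forall i, rational_over (h i)) -> rational_over (mmap iota h p).
Proof.
move=> rat_h; apply: big_ind => [|y z|m _]; [ | exact: rationalD | ].
  by rewrite -(rmorph0 iota); apply: rational_scalar.
by apply: rationalM (rational_scalar _) _; apply: rational_prod_exp.
Qed.

(** p / q is a root of q T - p. *)
Lemma rational_algebraic z : rational_over z -> algebraic_over iota x z.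
Proof.
move=> [p [q [nz_q ->]]]; pose Q : {poly {mpoly K[#|L|]}} := q%:P * 'X - p%:P.
have evQ : \poly_(d < size Q) ev Q`_d = (ev q)%:P * 'X - (ev p)%:P.
  by rewrite -[LHS]/(map_poly ev Q) rmorphB rmorphM /= !map_polyC map_polyX.
exists Q; rewrite /= evQ; split.
  apply: contra_neq nz_q => /(congr1 (fun u : {poly F} => u`_1)).
  by rewrite coefB coefMX coef0 !coefC subr0.
by rewrite /root hornerD hornerN hornerM hornerX !hornerC mulrCA divff // mulr1 subrr.
Qed.

End RationalClosure.

Section MutationRational.
Variables (K F : fieldType) (iota : {rmorphism K -> F}) (I J : finType).

Lemma mutation_rational (s0 s : seed F I J) (r : I + J) :
  mutation_equiv s0 s -> rational_over iota (seed_var s0) (seed_var s r).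
Proof.
move=> s0s; elim: s0s r => [|{}s z _ IHs] r; first exact: rational_gen.
rewrite /=; case: ifP => _ //; apply: rationalM; last exact: rationalV.
by apply: rationalD; apply: rational_prod_exp.
Qed.

End MutationRational.

Lemma initial_rowsE : model_rows initial_model =
  [:: tri 1 3 6; tri 2 3 6; tri 3 4 6; tri 3 5 6] ++ frozen_labels.
Proof. by vm_compute. Qed.

(** All four initial cluster variables involve both 3 and 6.  With v_3 and v_6 the
    first two basis vectors, they fix the third coordinates of v_1, v_2, v_4, v_5 up
    to sign.  The intervals containing 6 are then linear in the first coordinates
    and those containing 3 in the second ones.  Starting from v_4 with first
    coordinate 0 and from v_5 with second coordinate 0, they are solved one at a
    time along the chains 4, 5, 1, 2 and 5, 4, 2, 1. *)
Lemma initial_minors_onto (F : fieldType) (c : label -> F) :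
  {in members initial_model, forall l, c l != 0} ->
  exists m : nat -> nat -> F,
    {in model_rows initial_model, forall l, label_value m l = c l}.
Proof.
have -> : members initial_model = [:: tri 1 3 6; tri 2 3 6; tri 3 4 6; tri 3 5 6].
  by vm_compute.
move=> nz_c; rewrite initial_rowsE.
have nz1 : c (tri 1 3 6) != 0 by apply: nz_c.
have nz2 : c (tri 2 3 6) != 0 by apply: nz_c.
have nz4 : c (tri 3 4 6) != 0 by apply: nz_c.
have nz5 : c (tri 3 5 6) != 0 by apply: nz_c.
pose c1 := c (tri 1 3 6); pose c2 := c (tri 2 3 6).
pose c4 := c (tri 3 4 6); pose c5 := c (tri 3 5 6).
pose a5 := - c (tri 4 5 6) / c4.
pose a1 := (c1 * a5 - c (tri 1 5 6)) / - c5.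
pose a2 := (c (tri 1 2 6) + a1 * c2) / c1.
pose b4 := - c (tri 3 4 5) / c5.
pose b2 := (c2 * b4 - c (tri 2 3 4)) / - c4.
pose b1 := (c (tri 1 2 3) + c1 * b2) / c2.
(* The rows are the first, second and third coordinates of v_1, ..., v_6. *)
exists (fun i a => nth 0 (nth [::] [:: [:: a1; a2; 1; 0; a5; 0];
                                      [:: b1; b2; 0; b4; 0; 1];
                                      [:: c1; c2; 0; - c4; - c5; 0]] i) a.-1).
move=> l; rewrite !in_cons in_nil.
do 10 (case/predU1P => [->|];
  first by rewrite /= /det3 /= /b1 /b2 /b4 /a2 /a1 /a5 /c1 /c2 /c4 /c5; field;
    rewrite ?oppr_eq0 ?nz1 ?nz2 ?nz4 ?nz5).
by [].
Qed.

(** * The initial seed, the cluster algebra and the cluster variables *)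

Section InitialSeedFacts.
Variable K : numFieldType.
Local Notation ring := (grass_ring K 3 6).
Local Notation field := (grass_field K 3 6).
Local Notation I := (mutable_index 3 6).
Local Notation J := (frozen_index 3 6).
Local Notation s0 := (initial_seed K 3 6).
Local Notation iota := (@scalar_frac K 3 6).

(** A relation between the ten functions vanishes at all values that the ten
    minors take, so wherever the four initial cluster variables do not vanish. *)
Lemma initial_algebraically_independent :
  algebraically_independent iota (seed_var s0).
Proof.
have [S_model g_inj gS s_var _] := represents_initial K.
have f_inj := row_label_inj S_model g_inj gS.
have rowS r := row_label_mem r gS.
move=> P P0; pose lab (a : 'I_#|{: I + J}|) := row_label initial_label (enum_val a).
have P0_at M : P.@[fun a => label_value (entries M) (lab a)] = 0.
  have /(congr1 (evaluation M)) :
      mmap (@scalar_fun K 3 6) (fun a => label_fun K (lab a)) P = 0.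
    apply: regular_frac_inj; rewrite -mmap_regular_frac rmorph0 -[RHS]P0.
    by congr mmap; apply/funext => a; rewrite /= [RHS]s_var.
  rewrite evaluation_mmap rmorph0 => P0M; rewrite -[RHS]P0M.
  apply: meval_eq => a; apply/esym/evaluation_label_fun.
  apply: (model_rows_sub S_model); exact: rowS.
(* The dense set where the four initial cluster variables do not vanish. *)
apply: (@mpoly_eq0_fun_dense _ _ _ (\prod_(i : I) 'X_(enum_rank (inl i)))).
  by apply/prodf_neq0 => i _; rewrite -msupp_eq0 msuppX.
move=> v; rewrite rmorph_prod => /prodf_neq0 nz_v.
(* The values v, transported from the enumeration of I + J to labels. *)
pose c l := if [pick r | row_label initial_label r == l] is Some r
            then v (enum_rank r) else 0.
have c_row r : c (row_label initial_label r) = v (enum_rank r).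
  rewrite /c; case: pickP => [r' /eqP/f_inj -> //|/(_ r)].
  by rewrite eqxx.
have [l lS|m c_m] := @initial_minors_onto K c.
  have [i ->] := members_surj S_model g_inj gS lS.
  by rewrite (c_row (inl i)); have := nz_v i isT; rewrite /= mevalXU.
rewrite -(P0_at (\matrix_(i, a) m i a.+1)); apply: meval_eq => a.
rewrite -[v a](congr1 v (enum_valK a)) -c_row -c_m; last exact: rowS.
apply/esym/label_value_entries; apply: (model_rows_sub S_model); exact: rowS.
Qed.

Lemma regular_frac_Delta (A : {set 'I_6}) :
  #|A| = 3%N -> regular_frac (Delta K 3 A) = label_var K (set_label A).
Proof.
by move=> cardA; rewrite /label_var label_fun_Delta ?size_set_label // set_labelK.
Qed.

Lemma frozen_coefficient l :
  l \in frozen_labels -> coefficient s0 (label_var K l).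
Proof.
have [S_model g_inj gS s_var _] := represents_initial K.
move=> frl; have rowl : l \in model_rows initial_model by rewrite mem_cat frl orbT.
move: rowl; rewrite -(perm_mem (row_label_perm S_model g_inj gS)).
case/mapP => -[i|A] _ def_l; last by exists A; rewrite s_var -def_l.
have [_ _ subS _] := modelP S_model; have := label_disjoint (subS _ (gS i)).
by rewrite -[_ i]def_l frl.
Qed.

(** A 3-subset is a cyclic interval or internal. *)
Lemma Delta_generator (A : ksubset 3 6) :
  cluster_variable s0 (regular_frac (Delta K 3 (val A))) \/
  coefficient s0 (regular_frac (Delta K 3 (val A))).
Proof.
have cardA := eqP (valP A); rewrite regular_frac_Delta //.
have := label_of_3subset cardA; rewrite mem_cat => /orP[frA|intA].
  by right; apply: frozen_coefficient.
by left; apply/cluster_variableP; exists (set_label (val A)); rewrite // mem_cat intA.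
Qed.

(** Mutations are rational operations, and the Pluecker coordinates generate. *)
Lemma initial_generates (z : field) : rational_over iota (seed_var s0) z.
Proof.
have rat_regular f : rational_over iota (seed_var s0) (regular_frac f).
  rewrite [f]Delta_generate -mmap_regular_frac; apply: rational_mmap => a.
  have [[s s0s [i ->]]|[A ->]] := Delta_generator (enum_val a).
    exact: mutation_rational.
  exact: rational_gen.
have [n [d [_ ->]]] := fraction_quot z.
by apply: rationalM; [|apply: rationalV]; apply: rat_regular.
Qed.

Lemma initial_skew_symmetrizable :
  skew_symmetrizable (fun i j => seed_mx s0 (inl i) j).
Proof.
have [S_model g_inj gS _ s_mx] := represents_initial K.
exists (fun=> 1) => [i|i j]; first exact: ltr01.
rewrite 2!mul1r (s_mx (inl i)) (s_mx (inl j)).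
have : all (fun l => all (fun l' => model_mx initial_model l l' ==
    - model_mx initial_model l' l) (members initial_model)) (members initial_model).
  by vm_compute.
by move/allP/(_ _ (gS i))/allP/(_ _ (gS j))/eqP.
Qed.

Lemma initial_is_seed : is_seed iota s0.
Proof.
split; last exact: initial_skew_symmetrizable.
split; first exact: initial_algebraically_independent.
by move=> z; apply/rational_algebraic/initial_generates.
Qed.

(** The Pluecker coordinates generate the ring and belong to the cluster algebra;
    conversely cluster variables and coefficients are regular. *)
Lemma cluster_algebra_regular (z : field) :
  (exists f, z = regular_frac f) <-> cluster_algebra iota s0 z.
Proof.
split=> [[f ->]|[m [g [P [gP ->]]]]].
  exists _, (fun a => regular_frac (Delta K 3 (val (enum_val a)))), (repr f).
  split; first by move=> a; apply: Delta_generator.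
  by rewrite {1}[f]Delta_generate mmap_regular_frac.
have reg_g a : exists f, g a == regular_frac f.
  case: (gP a) => [/cluster_variableP[l _ ->]|[A ->]]; first by exists (label_fun K l).
  by eexists; apply: eqxx.
pose h a := xchoose (reg_g a); exists (mmap (@scalar_fun K 3 6) h P).
rewrite -mmap_regular_frac; congr mmap; apply/funext => a.
exact/eqP/(xchooseP (reg_g a)).
Qed.

Definition cluster_vars : seq field :=
  [seq regular_frac (Delta K 3 A) | A <- enum (internal 3 6)]
  ++ [:: regular_frac (X123456 K); regular_frac (Y123456 K)].

(** The given list of cluster variables follows the enumeration of sets, not the
    order of [mutable_labels]. *)
Lemma cluster_vars_perm : perm_eq cluster_vars (map (label_var K) mutable_labels).
Proof.
have -> : map (label_var K) mutable_labels
    = map (label_var K) internal_labels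
      ++ [:: regular_frac (X123456 K); regular_frac (Y123456 K)].
  by rewrite map_cat.
rewrite perm_cat2r perm_sym -(permPl (perm_map _ enum_internal)) -map_comp.
apply/permP => p; congr count; apply/eq_in_map => A.
rewrite mem_enum inE => /andP[/eqP cardA _].
by rewrite [RHS]regular_frac_Delta.
Qed.

Lemma cluster_vars_uniq : uniq cluster_vars.
Proof.
rewrite (perm_uniq cluster_vars_perm) map_inj_in_uniq ?label_var_inj //.
exact: label_var_inj.
Qed.

Lemma mem_cluster_vars (z : field) : cluster_variable s0 z <-> z \in cluster_vars.
Proof.
rewrite (perm_mem cluster_vars_perm) cluster_variableP.
by split=> [[l lP ->]|/mapP[l lP ->]]; [apply: map_f | exists l].
Qed.

End InitialSeedFacts.

(** * Concurrent lines *)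

Lemma sum_ord3 (V : nmodType) (F : 'I_3 -> V) :
  \sum_(i < 3) F i = F (inord 0) + F (inord 1) + F (inord 2).
Proof.
rewrite !big_ord_recl big_ord0 addr0 addrA.
by congr (F _ + F _ + F _); apply/val_inj; rewrite /= inordK.
Qed.

Section ConcurrentLines.
Variable K : numFieldType.
Implicit Types (u v w : 'cV[K]_3).

Definition bracket u v w : K :=
  det3 (fun i a => (nth 0 [:: u; v; w] a) (inord i) 0) 0 1 2.

Lemma det_rows3 u v w :
  \det (\matrix_(a < 3, i < 3) (nth 0 [:: u; v; w] a) i 0) = bracket u v w.
Proof.
rewrite -det_tr -[RHS]det_matrix3; congr (\det _).
by apply/matrixP => i a; rewrite !mxE inord_val.
Qed.

(** A singular matrix with rows u, v, w has a nonzero left kernel. *)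
Lemma bracket_eq0 u v w : bracket u v w = 0 ->
  exists a b c : K, ~~ [&& a == 0, b == 0 & c == 0] /\
    a *: u + b *: v + c *: w = 0.
Proof.
move/eqP; rewrite -det_rows3 => /det0P[r nz_r r0].
exists (r 0 (inord 0)), (r 0 (inord 1)), (r 0 (inord 2)); split.
  apply: contraNN nz_r => /and3P[/eqP r0_0 /eqP r0_1 /eqP r0_2].
  apply/eqP/rowP => j; rewrite mxE -(inord_val j).
  by case: j => [[|[|[|]]] lt_j].
apply/colP => i; have := congr1 (fun A : 'rV_3 => A 0 i) r0.
by rewrite !mxE sum_ord3 !mxE !inordK.
Qed.

Lemma line_eq v w : v != 0 -> (v \in <[w]>)%VS -> <[v]>%VS = <[w]>%VS.
Proof.
move=> nz_v /vlineP[c def_v].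
have nz_c : c != 0 by apply: contra_neq nz_v => c0; rewrite def_v c0 scale0r.
apply/eqP; rewrite eqEsubv -!memvE def_v memvZ ?memv_line //=.
by apply/vlineP; exists c^-1; rewrite scalerA mulVf ?scale1r.
Qed.

(** Since u and v are independent, a dependency between u, v, w has a nonzero
    coefficient at w. *)
Lemma mem_join u v w : u != 0 -> v != 0 -> <[u]>%VS != <[v]>%VS ->
  (w \in (<[u]> + <[v]>)%VS) = (bracket u v w == 0).
Proof.
move=> nz_u nz_v ne_uv; apply/idP/eqP => [|/bracket_eq0].
  case/memv_addP => _ /vlineP[a ->] [_ /vlineP[b ->] ->].
  by rewrite /bracket /det3 /= !mxE; ring.
case=> a [b [c [nz_abc dep]]].
have [c0|nz_c] := eqVneq c 0; last first.
  have cw : c *: w = - (a *: u + b *: v).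
    by apply/eqP; rewrite -addr_eq0 addrC dep.
  rewrite -[w](scalerK nz_c) cw memvZ ?memvN //.
  by rewrite memv_add ?memvZ ?memv_line.
case/eqP: ne_uv; rewrite c0 scale0r addr0 in dep.
have [a0|nz_a] := eqVneq a 0.
  move/eqP: dep; rewrite a0 scale0r add0r scaler_eq0 (negPf nz_v) orbF => b0.
  by rewrite a0 b0 c0 eqxx in nz_abc.
have au : a *: u = - (b *: v) by apply/eqP; rewrite -addr_eq0 dep.
by apply: line_eq; rewrite // -[u](scalerK nz_a) au memvZ ?memvN ?memvZ ?memv_line.
Qed.

(** A point of the projective plane is the line spanned by a nonzero vector. *)
Lemma concurrentP (L1 L2 L3 : {vspace 'cV[K]_3}) :
  concurrent L1 L2 L3 <->
  exists2 w, w != 0 & [/\ w \in L1, w \in L2 & w \in L3].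
Proof.
split=> [[P [dimP /subvP P1 /subvP P2 /subvP P3]]|[w nz_w [w1 w2 w3]]].
  exists (vpick P); first by rewrite vpick0 -dimv_eq0 dimP.
  by split; [apply: P1 | apply: P2 | apply: P3]; apply: memv_pick.
by exists <[w]>%VS; rewrite dim_vline nz_w -!memvE.
Qed.

(** The vector [n u v] is the cross product of u and v, that is, the normal of the
    plane that they span; the identity is the classical formula for the determinant
    of three cross products. *)
Lemma bracket_normals (v1 v2 v3 v4 v5 v6 : 'cV[K]_3) :
  let n u v := \col_i bracket u v (delta_mx i 0) in
  bracket (n v1 v2) (n v3 v4) (n v5 v6)
  = bracket v1 v3 v4 * bracket v2 v5 v6 - bracket v1 v5 v6 * bracket v2 v3 v4.
Proof.
move=> n; rewrite /bracket /det3 /= !mxE /bracket /det3 /= !mxE !eqxx !andbT.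
have ne (i j : nat) : (i < 3)%N -> (j < 3)%N ->
    ((inord i : 'I_3) == inord j) = (i == j).
  by move=> lt_i lt_j; rewrite -val_eqE /= !inordK.
by rewrite !ne //=; ring.
Qed.

(** Pairing with the normal of a plane is the bracket with two vectors spanning
    it, by linearity in the last argument. *)
Lemma bracketE u v w :
  \sum_(i < 3) bracket u v (delta_mx i 0) * w i 0 = bracket u v w.
Proof.
rewrite sum_ord3 /bracket /det3 /= !mxE !eqxx !andbT.
have ne (i j : nat) : (i < 3)%N -> (j < 3)%N ->
    ((inord i : 'I_3) == inord j) = (i == j).
  by move=> lt_i lt_j; rewrite -val_eqE /= !inordK.
by rewrite !ne //=; ring.
Qed.

(** Three covectors are dependent if and only if they have a common zero. *)
Lemma bracket_eq0_dual u v w : bracket u v w = 0 <->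
  exists2 p : 'cV[K]_3, p != 0 &
    {in [:: u; v; w], forall n : 'cV[K]_3, \sum_(i < 3) n i 0 * p i 0 = 0}.
Proof.
have prodE (p : 'cV[K]_3) a :
    (p^T *m (\matrix_(a < 3, i < 3) (nth 0 [:: u; v; w] a) i 0)^T) 0 a
    = \sum_(i < 3) (nth 0 [:: u; v; w] a) i 0 * p i 0.
  by rewrite mxE; apply: eq_bigr => i _; rewrite !mxE mulrC.
rewrite -det_rows3 -det_tr; split=> [/eqP/det0P[r nz_r r0]|[p nz_p p0]].
  exists r^T; first by rewrite trmx_eq0.
  move=> n n_in; have lt_n : (index n [:: u; v; w] < 3)%N by rewrite index_mem.
  have := prodE r^T (Ordinal lt_n).
  by rewrite trmxK r0 mxE [nth _ _ _](nth_index 0 n_in).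
apply/eqP/det0P; exists p^T; first by rewrite trmx_eq0.
by apply/rowP => a; rewrite prodE p0 ?mxE // mem_nth.
Qed.

(** X as a function of six vectors of K^3.  It is meaningful over the reals, which
    is where the geometric statement lives. *)
Definition X_bracket (v1 v2 v3 v4 v5 v6 : 'cV[K]_3) : K :=
  bracket v1 v3 v4 * bracket v2 v5 v6 - bracket v1 v5 v6 * bracket v2 v3 v4.

Lemma concurrent_X_bracket (v1 v2 v3 v4 v5 v6 : 'cV[K]_3) :
  v1 != 0 -> v2 != 0 -> v3 != 0 -> v4 != 0 -> v5 != 0 -> v6 != 0 ->
  <[v1]>%VS != <[v2]>%VS -> <[v3]>%VS != <[v4]>%VS -> <[v5]>%VS != <[v6]>%VS ->
  X_bracket v1 v2 v3 v4 v5 v6 = 0 <->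
  concurrent (<[v1]> + <[v2]>) (<[v3]> + <[v4]>) (<[v5]> + <[v6]>).
Proof.
move=> nz1 nz2 nz3 nz4 nz5 nz6 ne12 ne34 ne56.
rewrite concurrentP /X_bracket -bracket_normals bracket_eq0_dual.
have colE u v (p : 'cV[K]_3) :
    \sum_(i < 3) (\col_i bracket u v (delta_mx i 0)) i 0 * p i 0 = bracket u v p.
  by rewrite -bracketE; apply: eq_bigr => i _; rewrite mxE.
split=> -[p nz_p p_in]; exists p; rewrite ?nz_p //.
  by rewrite !mem_join // -!colE; split; apply/eqP/p_in; rewrite !inE eqxx ?orbT.
move=> n; case: p_in; rewrite !mem_join // => /eqP p12 /eqP p34 /eqP p56.
by rewrite !inE => /or3P[] /eqP ->; rewrite colE.
Qed.

Lemma evaluation_six_columns (v1 v2 v3 v4 v5 v6 : 'cV[K]_3) (l : label) :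
  l \in mutable_labels ->
  evaluation (six_columns v1 v2 v3 v4 v5 v6) (label_fun K l) =
  label_value (fun i a => (nth 0 [:: v1; v2; v3; v4; v5; v6] a.-1) (inord i) 0) l.
Proof.
move=> lP; have lP' : l \in mutable_labels ++ frozen_labels.
  by rewrite (mem_cat l mutable_labels) lP.
rewrite evaluation_label_fun //; apply: eq_label_value => i a lt_i l_a.
have /andP[a_gt0 a_le6] := label_range lP' l_a.
by rewrite /entries mxE !inordK ?prednK.
Qed.

Lemma regular_at_X (v1 v2 v3 v4 v5 v6 : 'cV[K]_3) :
  regular_at (X123456 K) (six_columns v1 v2 v3 v4 v5 v6)
  = X_bracket v1 v2 v3 v4 v5 v6.
Proof. exact: (@evaluation_six_columns _ _ _ _ _ _ X_label). Qed.

Lemma regular_at_Y (v1 v2 v3 v4 v5 v6 : 'cV[K]_3) :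
  regular_at (Y123456 K) (six_columns v1 v2 v3 v4 v5 v6)
  = X_bracket v6 v1 v2 v3 v4 v5.
Proof. exact: (@evaluation_six_columns _ _ _ _ _ _ Y_label). Qed.

End ConcurrentLines.

(** Used for the inclusion of the reals in the complex numbers. *)
Lemma X_bracket_map (K L : numFieldType) (phi : {rmorphism K -> L})
    (v1 v2 v3 v4 v5 v6 : 'cV[K]_3) :
  X_bracket (map_mx phi v1) (map_mx phi v2) (map_mx phi v3)
            (map_mx phi v4) (map_mx phi v5) (map_mx phi v6)
  = phi (X_bracket v1 v2 v3 v4 v5 v6).
Proof.
have mapE u v w : bracket (map_mx phi u) (map_mx phi v) (map_mx phi w)
    = phi (bracket u v w).
  rewrite -!det_rows3 -det_map_mx; congr (\det _); apply/matrixP => a i.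
  by rewrite !mxE; case: a => [[|[|[|]]] lt_a]; rewrite //= mxE.
by rewrite /X_bracket !mapE rmorphB !rmorphM.
Qed.

Lemma complexify_six_columns (R : realType) (v1 v2 v3 v4 v5 v6 : 'cV[R]_3) :
  complexify (six_columns v1 v2 v3 v4 v5 v6) =
  six_columns (complexify v1) (complexify v2) (complexify v3)
              (complexify v4) (complexify v5) (complexify v6).
Proof.
apply/matrixP => i a; rewrite !mxE.
by case: a => [[|[|[|[|[|[|]]]]]] lt_a]; rewrite //= mxE.
Qed.

Lemma real_regular_at_X (R : realType) (v1 v2 v3 v4 v5 v6 : 'cV[R]_3) :
  regular_at (X123456 R[i]) (complexify (six_columns v1 v2 v3 v4 v5 v6))
  = (X_bracket v1 v2 v3 v4 v5 v6)%:C%C.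
Proof. by rewrite complexify_six_columns regular_at_X X_bracket_map. Qed.

Lemma real_regular_at_Y (R : realType) (v1 v2 v3 v4 v5 v6 : 'cV[R]_3) :
  regular_at (Y123456 R[i]) (complexify (six_columns v1 v2 v3 v4 v5 v6))
  = (X_bracket v6 v1 v2 v3 v4 v5)%:C%C.
Proof. by rewrite complexify_six_columns regular_at_Y X_bracket_map. Qed.

Lemma real_complex_eq0 (R : realType) (c : R) : c%:C%C = 0 <-> c = 0.
Proof. by split=> [[]|->]. Qed.

Theorem theorem6 (R : realType) :
  let s0 := initial_seed R[i] 3 6 in
  let X := X123456 R[i] in
  let Y := Y123456 R[i] in
  let vars := [seq regular_frac (Delta R[i] 3 A) | A <- enum (internal 3 6)]
              ++ [:: regular_frac X; regular_frac Y] in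
  let at_real (f : grass_ring R[i] 3 6) (v1 v2 v3 v4 v5 v6 : 'cV[R]_3) :=
    regular_at f (complexify (six_columns v1 v2 v3 v4 v5 v6)) in
  [/\ [/\ is_seed (@scalar_frac R[i] 3 6) s0
        & forall z : grass_field R[i] 3 6,
            (exists f : grass_ring R[i] 3 6, z = regular_frac f)
            <-> cluster_algebra (@scalar_frac R[i] 3 6) s0 z],
      [/\ #|internal 3 6| = 14%N, uniq vars, size vars = 16%N
        & forall z : grass_field R[i] 3 6,
            cluster_variable s0 z <-> z \in vars],
      forall v1 v2 v3 v4 v5 v6 : 'cV[R]_3,
        v1 != 0 -> v2 != 0 -> v3 != 0 -> v4 != 0 -> v5 != 0 -> v6 != 0 ->
        [/\ <[v1]>%VS != <[v2]>%VS, <[v3]>%VS != <[v4]>%VS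
          & <[v5]>%VS != <[v6]>%VS] ->
        at_real X v1 v2 v3 v4 v5 v6 = 0 <->
        concurrent (<[v1]> + <[v2]>) (<[v3]> + <[v4]>) (<[v5]> + <[v6]>),
      forall v1 v2 v3 v4 v5 v6 : 'cV[R[i]]_3,
        regular_at Y (six_columns v1 v2 v3 v4 v5 v6)
        = regular_at X (six_columns v6 v1 v2 v3 v4 v5)
    & forall v1 v2 v3 v4 v5 v6 : 'cV[R]_3,
        v1 != 0 -> v2 != 0 -> v3 != 0 -> v4 != 0 -> v5 != 0 -> v6 != 0 ->
        (at_real Y v1 v2 v3 v4 v5 v6 = 0
         <-> at_real X v6 v1 v2 v3 v4 v5 = 0) /\
        ([/\ <[v6]>%VS != <[v1]>%VS, <[v2]>%VS != <[v3]>%VS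
           & <[v4]>%VS != <[v5]>%VS] ->
         at_real Y v1 v2 v3 v4 v5 v6 = 0 <->
         concurrent (<[v6]> + <[v1]>) (<[v2]> + <[v3]>) (<[v4]> + <[v5]>))].
Proof.
move=> s0 X Y vars at_real; split.
- by split; [exact: initial_is_seed | exact: cluster_algebra_regular].
- split; [exact: card_internal | exact: cluster_vars_uniq | |].
    by rewrite size_cat size_map -cardE card_internal.
  exact: mem_cluster_vars.
- move=> v1 v2 v3 v4 v5 v6 nz1 nz2 nz3 nz4 nz5 nz6 [ne12 ne34 ne56].
  rewrite /at_real real_regular_at_X real_complex_eq0.
  exact: concurrent_X_bracket.
- by move=> v1 v2 v3 v4 v5 v6; rewrite regular_at_Y regular_at_X.
move=> v1 v2 v3 v4 v5 v6 nz1 nz2 nz3 nz4 nz5 nz6.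
rewrite /at_real real_regular_at_Y real_regular_at_X; split=> // -[ne61 ne23 ne45].
by rewrite real_complex_eq0; apply: concurrent_X_bracket.
Qed.
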